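(* Let $d \geq 3$, let $T_d$ be the $d$-regular tree, and let $\Gamma$ be a cocompact lattice in $G = \mathrm{Aut}(T_d)$. Then the commensurator $\mathrm{Comm}_G(\Gamma)$ of $\Gamma$ in $G$ admits a proper quotient that is free abelian of infinite rank. In particular $\mathrm{Comm}_G(\Gamma)$ is not virtually simple.
   Context: $\mathrm{Aut}(T_d)$ is the automorphism group of the $d$-regular tree, a totally disconnected locally compact group for the topology of pointwise convergence on vertices. Two subgroups of a group are commensurable if their intersection has finite index in each of them. For a discrete subgroup $\Gamma$ of a locally compact group $G$, the commensurator $\mathrm{Comm}_G(\Gamma)$ is the subgroup of all $g \in G$ such that $\Gamma$ and $g\Gamma g^{-1}$ are commensurable. A proper quotient of a group is a quotient by a non-trivial normal subgroup. A group is virtually simple if it has a finite index subgroup that is simple. *)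

(* Defs.v *)
From HB Require Import structures.
From mathcomp Require Import all_boot all_algebra.
From mathcomp Require Import all_classical topology.
From mathcomp Require Import freeg.

Set Implicit Arguments.
Unset Strict Implicit.
Unset Printing Implicit Defensive.

Local Open Scope classical_set_scope.
Local Open Scope quotient_scope.
Local Open Scope group_scope.

Record subgroup (G : groupType) := Subgroup {
  carrier :> set G;
  subgroup1 : carrier 1;
  subgroupM : forall x y, carrier x -> carrier y ->
                          carrier (x * y);
  subgroupV : forall x, carrier x -> carrier x^-1 }.

Lemma subgroup_group_closed (G : groupType) (H : subgroup G) :
  group_closed [in carrier H].
Proof.
split=> [|x y]; rewrite !inE; first exact: subgroup1.
by move=> Hx Hy; apply: subgroupM => //; apply: subgroupV.
Qed.

(* A subgroup H, used as a type, is the sigma type of its elements; this makes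
   it a group in its own right. *)
HB.instance Definition _ (G : groupType) (H : subgroup G) :=
  SubChoice.copy (set_type H) {x : G | x \in carrier H}.
HB.instance Definition _ (G : groupType) (H : subgroup G) :=
  SubChoice_isSubGroup.Build G _ (set_type H) (subgroup_group_closed H).

Section Cosets.
Variables (G : groupType) (H : subgroup G).

(* The classes are the left cosets: x H = y H. *)
Definition coset_rel (x y : G) : bool := `[< carrier H (x^-1 * y) >].

Lemma coset_rel_refl : reflexive coset_rel.
Proof. by move=> x; apply/asboolP; rewrite mulVg; exact: subgroup1. Qed.

Lemma coset_rel_sym : symmetric coset_rel.
Proof.
by move=> x y; apply/asboolP/asboolP => /subgroupV; rewrite invgM invgK.
Qed.

Lemma coset_rel_trans : transitive coset_rel.
Proof.
move=> y x z /asboolP Hxy /asboolP Hyz; apply/asboolP.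
by have := subgroupM Hxy Hyz; rewrite mulgA mulgK.
Qed.

Canonical coset_equiv :=
  EquivRel coset_rel coset_rel_refl coset_rel_sym coset_rel_trans.

Definition coset_space := {eq_quot coset_equiv}.
HB.instance Definition _ := Choice.on coset_space.
HB.instance Definition _ : EqQuotient G coset_equiv coset_space :=
  EqQuotient.on coset_space.

End Cosets.

Record normal_subgroup (G : groupType) := NormalSubgroup {
  normal_set :> subgroup G;
  normalJ : forall x y, carrier normal_set x ->
                        carrier normal_set (y * x * y^-1) }.

Section QuotientGroup.
Variables (G : groupType) (N : normal_subgroup G).

Definition quotient_group := coset_space N.
HB.instance Definition _ := EqQuotient.on quotient_group.
HB.instance Definition _ := Choice.on quotient_group.

Definition quotient_one : quotient_group := \pi_quotient_group 1.
Definition quotient_mul (a b : quotient_group) : quotient_group :=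
  \pi_quotient_group (repr a * repr b).
Definition quotient_inv (a : quotient_group) : quotient_group :=
  \pi_quotient_group (repr a)^-1.

Lemma quotient_eqP (x y : G) :
  reflect (x = y %[mod quotient_group]) `[< carrier N (x^-1 * y) >].
Proof. exact: eqmodP. Qed.

Lemma pi_mulg (x y : G) :
  \pi_quotient_group (x * y) =
  quotient_mul (\pi_quotient_group x) (\pi_quotient_group y).
Proof.
rewrite /quotient_mul; case: piP => x' /quotient_eqP/asboolP Nx.
case: piP => y' /quotient_eqP/asboolP Ny; apply/quotient_eqP/asboolP.
have := subgroupM (normalJ y^-1 Nx) Ny.
by rewrite invgK !invgM !mulgA mulgK.
Qed.

Lemma pi_invg (x : G) :
  \pi_quotient_group x^-1 = quotient_inv (\pi_quotient_group x).
Proof.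
rewrite /quotient_inv; case: piP => x' /quotient_eqP/asboolP Nx.
apply/quotient_eqP/asboolP; have := normalJ x (subgroupV Nx).
by rewrite invgM !invgK mulgA mulgK.
Qed.

Lemma quotient_mulA : associative quotient_mul.
Proof.
move=> a b c; rewrite -[a]reprK -[b]reprK -[c]reprK.
move: (repr a) (repr b) (repr c) => x y z.
by rewrite -(pi_mulg y z) -(pi_mulg x y) -2!pi_mulg mulgA.
Qed.

Lemma quotient_mul1 : left_id quotient_one quotient_mul.
Proof. by move=> a; rewrite -[a]reprK -pi_mulg mul1g. Qed.

Lemma quotient_mulr1 : right_id quotient_one quotient_mul.
Proof. by move=> a; rewrite -[a]reprK -pi_mulg mulg1. Qed.

Lemma quotient_mulV : left_inverse quotient_one quotient_inv quotient_mul.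
Proof. by move=> a; rewrite -[a]reprK -pi_invg -pi_mulg mulVg. Qed.

Lemma quotient_mulrV : right_inverse quotient_one quotient_inv quotient_mul.
Proof. by move=> a; rewrite -[a]reprK -pi_invg -pi_mulg mulgV. Qed.

HB.instance Definition _ := isGroup.Build quotient_group
  quotient_mulA quotient_mul1 quotient_mulr1 quotient_mulV quotient_mulrV.

End QuotientGroup.

(* Meant for K contained in H: the cosets xK with x in H are finitely many. *)
Definition finite_index (G : groupType) (K : subgroup G) (H : set G) :=
  finite_set [set \pi_(coset_space K) x | x in H].

Definition simple_group (G : groupType) :=
  (exists x : G, x <> 1) /\
  forall N : normal_subgroup G, carrier N = [set 1] \/ carrier N = setT.

Definition virtually_simple (G : groupType) :=
  exists2 H : subgroup G, finite_index H setT & simple_group H.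

(* {freeg I} is the free abelian group with basis I. *)
Definition free_abelian_of_infinite_rank (A : groupType) :=
  exists (I : choiceType) (f : A -> {freeg I}),
    [/\ infinite_set [set: I], bijective f &
        {morph f : x y / x * y >-> (x + y)%R}].

Section Commensurator.
Variable G : groupType.
Implicit Types H K L : subgroup G.

Program Definition subgroupI H K : subgroup G :=
  @Subgroup G (H `&` K) _ _ _.
Next Obligation. by move=> H K; split; exact: subgroup1. Qed.
Next Obligation.
by move=> H K x y [? ?] [? ?]; split; exact: subgroupM.
Qed.
Next Obligation. by move=> H K x [? ?]; split; exact: subgroupV. Qed.

Program Definition conj_subgroup (g : G) H : subgroup G :=
  @Subgroup G [set g * h * g^-1 | h in H] _ _ _.
Next Obligation.
by move=> g H; exists 1; [exact: subgroup1|rewrite mulg1 mulgV].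
Qed.
Next Obligation.
move=> g H _ _ [x Hx <-] [y Hy <-]; exists (x * y); first exact: subgroupM.
by rewrite !mulgA mulgVK.
Qed.
Next Obligation.
move=> g H _ [x Hx <-]; exists x^-1; first exact: subgroupV.
by rewrite !invgM invgK mulgA.
Qed.

Definition commensurable H K :=
  finite_index (subgroupI H K) H /\ finite_index (subgroupI H K) K.

Lemma coset_eqP H x y :
  \pi_(coset_space H) x = \pi_(coset_space H) y <-> carrier H (x^-1 * y).
Proof. by split=> [/eqmodP/asboolP|?] //; apply/eqmodP/asboolP. Qed.

(* H is covered by finitely many left cosets of K *)
Definition few_cosets H K :=
  exists2 S : set G, finite_set S &
    forall x, carrier H x -> exists2 s, S s & carrier K (s^-1 * x).

Lemma finite_indexP H K L : (forall x, carrier L x <-> carrier H x /\ carrier K x) ->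
  finite_index L H <-> few_cosets H K.
Proof.
move=> LP; split=> [finL|[S finS coverS]].
  exists (repr @` [set \pi_(coset_space L) x | x in H]).
    exact: finite_image.
  move=> x Hx; exists (repr (\pi_(coset_space L) x)).
    by exists (\pi_(coset_space L) x) => //; exists x.
  suff /LP[] : carrier L ((repr (\pi_(coset_space L) x))^-1 * x) by [].
  by apply/coset_eqP; rewrite reprK.
pose c s := xget 1 [set x | carrier H x /\ carrier K (s^-1 * x)].
apply: (@sub_finite_set _ _ (\pi_(coset_space L) @` (c @` S))); last first.
  by do 2!apply: finite_image.
move=> _ [x Hx <-]; have [s Ss Ksx] := coverS x Hx.
exists (c s); first by exists s.
have [Hc Kc] : carrier H (c s) /\ carrier K (s^-1 * c s).
  by apply: (@xgetPex _ 1 [set x | carrier H x /\ carrier K (s^-1 * x)]); exists x.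
apply/coset_eqP/LP; split; first exact: subgroupM (subgroupV Hc) Hx.
by have := subgroupM (subgroupV Kc) Ksx; rewrite invgM invgK mulgA mulgK.
Qed.

Lemma commensurableP H K : commensurable H K <-> few_cosets H K /\ few_cosets K H.
Proof.
have HK : forall x, carrier (subgroupI H K) x <-> carrier H x /\ carrier K x by [].
have KH x : carrier (subgroupI H K) x <-> carrier K x /\ carrier H x by split=> -[].
by split=> -[/(finite_indexP HK) ? /(finite_indexP KH) ?].
Qed.

Lemma few_cosets_trans H K L : few_cosets H K -> few_cosets K L -> few_cosets H L.
Proof.
move=> [S finS HS] [S' finS' KS'].
exists [set s * s' | s in S & s' in S']; first exact: finite_image2.
move=> x /HS[s Ss /KS'[s' Ss' Ls']].
by exists (s * s'); [exists s => //; exists s'|rewrite invgM -mulgA].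
Qed.

Lemma few_cosetsJ g H K :
  few_cosets H K -> few_cosets (conj_subgroup g H) (conj_subgroup g K).
Proof.
move=> [S finS HS]; exists [set g * s * g^-1 | s in S].
  exact: finite_image.
move=> _ [x /HS[s Ss Ks] <-]; exists (g * s * g^-1); first by exists s.
by exists (s^-1 * x) => //; rewrite !invgM invgK !mulgA mulgVK.
Qed.

Lemma few_cosets_conjM g h H :
  few_cosets (conj_subgroup (g * h) H) (conj_subgroup g (conj_subgroup h H))
  /\ few_cosets (conj_subgroup g (conj_subgroup h H)) (conj_subgroup (g * h) H).
Proof.
split; exists [set 1] => // x Hx; exists 1 => //; rewrite invg1 mul1g;
  move: Hx.
  move=> [y Hy <-]; exists (h * y * h^-1); first by exists y.
  by rewrite invgM !mulgA.
by move=> [_ [y Hy <-] <-]; exists y => //; rewrite invgM !mulgA.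
Qed.

Lemma few_cosets_conj1 H :
  few_cosets (conj_subgroup 1 H) H /\ few_cosets H (conj_subgroup 1 H).
Proof.
split; exists [set 1] => // x Hx; exists 1 => //; rewrite invg1 mul1g.
  by case: Hx => y Hy <-; rewrite invg1 mulg1 mul1g.
by exists x; rewrite // invg1 mulg1 mul1g.
Qed.

Program Definition commensurator H : subgroup G :=
  @Subgroup G [set g | commensurable H (conj_subgroup g H)] _ _ _.
Next Obligation.
by move=> H /=; apply/commensurableP; have [? ?] := few_cosets_conj1 H.
Qed.
Next Obligation.
move=> H x y /= /commensurableP[x1 x2] /commensurableP[y1 y2].
have [xy1 xy2] := few_cosets_conjM x y H.
apply/commensurableP; split.
  by apply: (few_cosets_trans x1); apply: few_cosets_trans xy2; apply: few_cosetsJ.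
by apply: (few_cosets_trans xy1); apply: few_cosets_trans x2; apply: few_cosetsJ.
Qed.
Next Obligation.
move=> H x /= /commensurableP[/(few_cosetsJ x^-1) x1 /(few_cosetsJ x^-1) x2].
have [] := few_cosets_conjM x^-1 x H; have [] := few_cosets_conj1 H.
rewrite mulVg => a b c d; apply/commensurableP; split.
  by apply: (few_cosets_trans b); apply: (few_cosets_trans c).
by apply: (few_cosets_trans x1); apply: (few_cosets_trans d).
Qed.

End Commensurator.

Section Tree.
Variables (V : choiceType) (adj : rel V).

Record is_tree : Prop := IsTree {
  tree_inhabited : exists x : V, True;
  tree_sym : symmetric adj;
  tree_irr : irreflexive adj;
  tree_connected : forall x y, exists2 p, path adj x p & last x p = y;
  (* an edge x y gives the ucycle [:: x; y], hence the bound 2 *)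
  tree_acyclic : forall c, ucycle adj c -> (size c <= 2)%N }.

Definition regular_graph (d : nat) := forall x, ([set y | adj x y] #= `I_d)%card.

Definition is_automorphism (f : V -> V) :=
  bijective f /\ forall x y, adj (f x) (f y) = adj x y.

Record graph_aut := GraphAut {
  aut_fun :> V -> V;
  aut_axiom : `[< is_automorphism aut_fun >] }.

HB.instance Definition _ := [isSub for aut_fun].
HB.instance Definition _ := [Choice of graph_aut by <:].

Lemma autP (f : graph_aut) : is_automorphism f.
Proof. by case: f => f fP; apply/asboolP. Qed.

Lemma aut_one_subproof : is_automorphism id.
Proof. by split=> //; exists id. Qed.

Lemma aut_mul_subproof (f g : graph_aut) : is_automorphism (f \o g).
Proof.
have [[bijf adjf] [bijg adjg]] := (autP f, autP g).
by split=> [|x y]; [exact: bij_comp|rewrite /= adjf adjg].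
Qed.

Lemma aut_inv_ex (f : graph_aut) :
  exists g : V -> V, [/\ cancel f g, cancel g f & is_automorphism g].
Proof.
have [[g fK gK] adjf] := autP f; exists g; split=> //; split.
  by exists f.
by move=> x y; rewrite -adjf !gK.
Qed.

Lemma aut_eq (f g : graph_aut) : aut_fun f =1 aut_fun g -> f = g.
Proof. by move=> fg; apply: val_inj; apply/funext. Qed.

Definition aut_one := GraphAut (introT (asboolP _) aut_one_subproof).
Definition aut_mul f g := GraphAut (introT (asboolP _) (aut_mul_subproof f g)).
Definition inv_fun (f : graph_aut) : V -> V := projT1 (cid (aut_inv_ex f)).

Lemma inv_funP (f : graph_aut) :
  [/\ cancel f (inv_fun f), cancel (inv_fun f) f & is_automorphism (inv_fun f)].
Proof. exact: projT2 (cid (aut_inv_ex f)). Qed.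

Lemma aut_inv_subproof (f : graph_aut) : is_automorphism (inv_fun f).
Proof. by have [] := inv_funP f. Qed.

Definition aut_inv f := GraphAut (introT (asboolP _) (aut_inv_subproof f)).

Lemma aut_mulA : associative aut_mul.
Proof. by move=> f g h; exact: aut_eq. Qed.
Lemma aut_mul1 : left_id aut_one aut_mul.
Proof. by move=> f; exact: aut_eq. Qed.
Lemma aut_mulr1 : right_id aut_one aut_mul.
Proof. by move=> f; exact: aut_eq. Qed.
Lemma aut_mulV : left_inverse aut_one aut_inv aut_mul.
Proof.
by move=> f; apply: aut_eq => x /=; have [fK gK _] := inv_funP f; rewrite ?fK ?gK.
Qed.
Lemma aut_mulrV : right_inverse aut_one aut_inv aut_mul.
Proof.
by move=> f; apply: aut_eq => x /=; have [fK gK _] := inv_funP f; rewrite ?fK ?gK.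
Qed.

HB.instance Definition _ :=
  isGroup.Build graph_aut aut_mulA aut_mul1 aut_mulr1 aut_mulV aut_mulrV.

(* the topology of pointwise convergence on the discrete set V *)
HB.instance Definition _ := Topological.copy graph_aut
  (initial_topology (aut_fun : graph_aut -> {ptws V -> discrete_topology V})).

(* set_type H carries the topology induced by graph_aut. *)
Definition discrete_subgroup (H : subgroup graph_aut) :=
  forall A : set (set_type H), open A.

Definition cocompact_subgroup (H : subgroup graph_aut) :=
  compact [set: quotient_topology (coset_space H)].

Definition cocompact_lattice (H : subgroup graph_aut) :=
  discrete_subgroup H /\ cocompact_subgroup H.

End Tree.

(* Main.v *)
Require Import Defs.
From mathcomp Require Import all_classical topology freeg.
From mathcomp Require Import all_boot all_algebra all_fingroup all_solvable.

(** For a finite group F and a prime p let m_p(F) be the number of composition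
factors of F that are cyclic of order p.  It is additive on extensions
([subnormal_count_extension]).  Hence,
if B has finite index in an arbitrary group A, and K is a normal subgroup of
finite index of A contained in B, the integer m_p(A/K) - m_p(B/K) does not
depend on K ([quotient_index_indep]).  This index is additive in towers and
invariant under conjugation, so that comparing Gamma and g Gamma g^-1 with their
intersection defines a homomorphism [comm_hom] from the commensurator of Gamma
to the integers.  Two subgroups of the same index can differ for m_p, because
their normal cores can have different quotients; this is why these
homomorphisms can be nonzero although conjugation preserves the covolume.  For a
given g almost all p give 0 ([comm_hom_bounded]), so the family over the primes
p >= 5 is a homomorphism to a free abelian group of infinite rank.

It is onto as soon as every p >= 5 has an element g with value 1 at p and value
0 at all q > p ([triangular_onto]).  To find g, replace Gamma by a convenient
group.  A legal colouring of the edges of the tree by d colours makes the tree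
a copy of the Cayley graph of the free product of d groups of order 2, so its
group of automorphisms is simply transitive on the vertices.  Every cocompact
lattice is commensurable to such a group ([lattice_coloring]), and commensurable
groups have the same commensurator.  Now let the colours act on Z/p: with
x |-> -x and x |-> 1-x as the only nontrivial involutions, the group
generated is dihedral and has m_p = 1.  The same Schreier graph can be recoloured
by giving the edge {0, 1} one colour and all other edges x -- 1-x another
colour; then a transposition appears, the group generated is the symmetric
group of degree p, and m_p = 0.  Lifted to the tree this recolouring is a second
legal colouring, and the tree automorphism g that carries the first to the second
is the required element ([recoloring_witness], [coloring_aut_witness]).

A simple subgroup of finite index would either lie in the kernel, so that the
free abelian quotient would be finite, or embed in the free abelian group; a
simple abelian group that embeds there equals its subgroup of squares, which is
impossible because no nonzero element of a free abelian group is divisible by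
all powers of 2. *)

Set Implicit Arguments.
Unset Strict Implicit.
Unset Printing Implicit Defensive.
Local Open Scope quotient_scope.
Local Open Scope group_scope.

(** * Steps of prime index in subnormal chains of finite groups *)

Section SubnormalChains.
Variable p : nat.

(** The number recorded counts the steps of index p of a chain, not its length. It is
at most the multiplicity of Z/p as a composition factor, with equality on the
refinements to composition series. *)
Inductive subnormal_steps (gT : finGroupType) : {group gT} -> nat -> Prop :=
| steps_trivial : subnormal_steps 1%G 0
| steps_cons (G H : {group gT}) k :
    H <| G -> subnormal_steps H k ->
    subnormal_steps G (k + (#|G : H| == p)).

Hypothesis p_pr : prime p.

(** The index of a subgroup divides the order, so each step of index p uses up a
factor p of the order of the group. *)
Lemma subnormal_steps_le_logn (gT : finGroupType) (G : {group gT}) k :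
  subnormal_steps G k -> (k <= logn p #|G|)%N.
Proof.
elim=> [|{}G H {}k nHG _ IH] //.
have sHG := normal_sub nHG.
rewrite -(Lagrange sHG) lognM ?cardG_gt0 ?indexg_gt0 // leq_add //.
by case: eqP => // ->; rewrite logn_prime // eqxx.
Qed.

Lemma subnormal_steps_ex (gT : finGroupType) (G : {group gT}) :
  exists k, subnormal_steps G k.
Proof. by eexists; apply: (steps_cons (normal1 G)); exact: steps_trivial. Qed.

(** The multiplicity of Z/p among the composition factors. Defining it as a maximum
over all subnormal chains makes it well defined at once, and leaves the additivity
on extensions to be shown by cutting and gluing chains, without the
Jordan-Hoelder theorem. *)
Definition subnormal_count (gT : finGroupType) (G : {group gT}) : nat :=
  \max_(k < (logn p #|G|).+1 | `[< subnormal_steps G k >]) k.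

Lemma subnormal_countP (gT : finGroupType) (G : {group gT}) :
  subnormal_steps G (subnormal_count G).
Proof.
have [k Gk] := subnormal_steps_ex G.
have kb : (k < (logn p #|G|).+1)%N by rewrite ltnS subnormal_steps_le_logn.
pose A := [pred i : 'I_(logn p #|G|).+1 | `[< subnormal_steps G i >]].
have A_gt0 : (0 < #|A|)%N.
  by apply/card_gt0P; exists (Ordinal kb); rewrite !inE; apply/asboolP.
have [i /asboolP Gi E] := eq_bigmax_cond (@nat_of_ord _) A_gt0.
by have -> : subnormal_count G = i :> nat by exact: E.
Qed.

Lemma subnormal_count_max (gT : finGroupType) (G : {group gT}) k :
  subnormal_steps G k -> (k <= subnormal_count G)%N.
Proof.
move=> Gk; have kb : (k < (logn p #|G|).+1)%N by rewrite ltnS subnormal_steps_le_logn.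
by apply: (bigmax_sup (Ordinal kb)) => //; apply/asboolP.
Qed.

Lemma subnormal_count_le_logn (gT : finGroupType) (G : {group gT}) :
  (subnormal_count G <= logn p #|G|)%N.
Proof. exact/subnormal_steps_le_logn/subnormal_countP. Qed.

Section Extension.
Variables (aT rT : finGroupType) (D : {group aT}) (h : {morphism D >-> rT}).

Lemma index_kernel_image (G H : {group aT}) : H \subset G -> G \subset D ->
  #|G : H| = (#|'ker_G h : 'ker_H h| * #|h @* G : h @* H|)%N.
Proof.
move=> sHG sGD; have sHD := subset_trans sHG sGD.
have cardE (K : {group aT}) : K \subset D -> #|K| = (#|'ker_K h| * #|h @* K|)%N.
  move=> sKD; rewrite card_morphim (setIidPr sKD).
  by rewrite -indexgI Lagrange ?subsetIl.
apply/eqP; rewrite -(eqn_pmul2l (cardG_gt0 H)) Lagrange //.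
rewrite (cardE G) // (cardE H) // mulnACA !Lagrange //.
  exact: morphimS.
exact: setSI.
Qed.

(** A chain of the image pulls back to a chain from G down to the kernel with the
same indices, and continues inside the kernel. *)
Lemma steps_extension (G : {group aT}) k l : G \subset D ->
  subnormal_steps ('ker_G h)%G k -> subnormal_steps (h @* G)%G l ->
  subnormal_steps G (k + l).
Proof.
move=> sGD Kk; move E: (h @* G)%G => X Xl.
elim: Xl G sGD Kk E => [G sGD Kk|{X} X Y {}l nYX Yl IH G sGD Kk E].
  move=> /(congr1 val)/= hG1; rewrite addn0.
  have -> // : G = ('ker_G h)%G.
  by apply/val_inj/esym/setIidPl; rewrite ker_trivg_morphim sGD hG1 subxx.
have sYX := normal_sub nYX.
have sYh : Y \subset h @* D by rewrite (subset_trans sYX) // -E morphimS.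
pose H := (G :&: h @*^-1 Y)%G.
have hH : (h @* H)%G = Y.
  apply/val_inj; rewrite /= morphimIG ?ker_sub_pre // morphpreK //.
  by move: E => /(congr1 val)/= ->; apply/setIidPr.
have sHG : H \subset G by exact: subsetIl.
have KH : 'ker_H h = 'ker_G h.
  by rewrite /= -setIA (setIidPr (ker_sub_pre _ _)).
have nHG : H <| G.
  rewrite /normal sHG /= normsI ?normG //.
  rewrite (subset_trans _ (morphpre_norm _ _)) // -sub_morphim_pre //.
  by move: E => /(congr1 val)/= ->; exact: normal_norm.
have -> : #|X : Y| = #|G : H|.
  rewrite index_kernel_image // KH indexgg mul1n.
  by move/(congr1 val): hH => /= ->; move/(congr1 val): E => /= ->.
rewrite addnA; apply: (steps_cons nHG); apply: IH => //.
  exact: subset_trans sGD.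
by rewrite (_ : 'ker_H h = 'ker_G h)%G //; apply: val_inj.
Qed.

(** Intersect a chain with the kernel and take its image. The index of each step is
the product of the indices in the two new chains; when it is the prime p, one of
the two factors is p, so no step of index p is lost. *)
Lemma steps_split (G : {group aT}) k : G \subset D -> subnormal_steps G k ->
  exists k1 k2, [/\ subnormal_steps ('ker_G h)%G k1,
                    subnormal_steps (h @* G)%G k2 & (k <= k1 + k2)%N].
Proof.
move=> sGD Gk; elim: Gk sGD => [|{}G H {}k nHG _ IH] sGD.
  exists 0, 0; split=> //.
    by rewrite (_ : ('ker_1 h)%G = 1%G); [constructor | apply/val_inj/setI1g].
  by rewrite (_ : (h @* 1)%G = 1%G); [constructor | apply/val_inj/morphim1].
have sHG := normal_sub nHG.
have [k1 [k2 [s1 s2 le_k]]] := IH (subset_trans sHG sGD).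
have nK : ('ker_H h)%G <| ('ker_G h)%G.
  by rewrite /normal setSI //= normsI // ?(subset_trans (subsetIl _ _) (normal_norm nHG)) //
    (subset_trans (subsetIr _ _)) ?normG.
have nI : (h @* H)%G <| (h @* G)%G by exact: morphim_normal.
do 2!eexists; split; [exact: steps_cons nK s1|exact: steps_cons nI s2|].
rewrite addnACA leq_add //; case: eqP => // iG.
have := p_pr; rewrite -iG index_kernel_image //.
set a := #|_ : _|; set b := #|_ : _| => /primeP[_ /(_ a (dvdn_mulr _ _))].
rewrite dvdnn => /(_ isT)/orP[/eqP a1|/eqP <-]; last by rewrite eqxx.
by rewrite /= -/b a1 mul1n eqxx addn1.
Qed.

Lemma subnormal_count_extension (G : {group aT}) : G \subset D ->
  subnormal_count G =
  (subnormal_count ('ker_G h)%G + subnormal_count (h @* G)%G)%N.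
Proof.
move=> sGD; apply/eqP; rewrite eqn_leq; apply/andP; split.
  have [k1 [k2 [s1 s2 le_k]]] := steps_split sGD (subnormal_countP G).
  by rewrite (leq_trans le_k) // leq_add // subnormal_count_max.
apply: subnormal_count_max; apply: steps_extension => //;
  exact: subnormal_countP.
Qed.

End Extension.

Lemma subnormal_count_p'group (gT : finGroupType) (G : {group gT}) :
  ~~ (p %| #|G|) -> subnormal_count G = 0.
Proof.
move=> pG; apply/eqP; rewrite -leqn0 (leq_trans (subnormal_count_le_logn G)) //.
by rewrite lognE p_pr cardG_gt0 /= (negPf pG).
Qed.

Lemma subnormal_count_normal_prime (gT : finGroupType) (G R : {group gT}) :
  R <| G -> #|R| = p -> logn p #|G| = 1%N -> subnormal_count G = 1%N.
Proof.
move=> nRG cR lG; apply/eqP; rewrite eqn_leq -{1}lG subnormal_count_le_logn /=.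
have : subnormal_steps G (0 + (#|R : 1%G| == p) + (#|G : R| == p)).
  by apply: steps_cons nRG _; apply: steps_cons (normal1 _) _; constructor.
move/subnormal_count_max; rewrite indexg1 cR eqxx.
by apply: leq_trans; rewrite add0n leq_addr.
Qed.

(** A normal subgroup of a simple group is trivial or everything, so the only
proper step has index the order of the group. *)
Lemma subnormal_count_simple (gT : finGroupType) (G : {group gT}) :
  simple G -> #|G| != p -> subnormal_count G = 0.
Proof.
move=> simG nGp; have: subnormal_steps G (subnormal_count G) by exact: subnormal_countP.
move: (subnormal_count G) => k; move E: G => A Ak; elim: Ak E => // {}A H {}k nHA Hk IH E.
subst A; have [_ /(_ _ nHA)[H1|HA]] := simpleP _ simG.
  have := subnormal_steps_le_logn Hk.
  by rewrite H1 cards1 logn1 leqn0 indexg1 (negPf nGp) => /eqP->.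
rewrite HA indexgg (IH _) ?add0n; last exact/esym/val_inj.
by case: eqP => // p1; move: p_pr; rewrite -p1.
Qed.

(** The composition factors of a symmetric group of degree at least 5 are Z/2 and a
non-abelian simple group. *)
Lemma subnormal_count_Sym (T : finType) : #|T| = p -> (4 < p)%N ->
  subnormal_count [set: {perm T}]%G = 0.
Proof.
move=> cT p_gt4; have simA : simple 'Alt_T by apply: simple_Alt5; rewrite cT.
have p_gt1 : (1 < p)%N by exact: ltn_trans p_gt4.
have cA : (2 * #|'Alt_T|)%N = p`! by rewrite card_Alt cT.
pose h := [morphism of @odd_perm T].
have im0 : subnormal_count (h @* [set: {perm T}])%G = 0.
  apply/subnormal_count_p'group/negP => /(dvdn_leq (cardG_gt0 _)); apply/negP.
  by rewrite -ltnNge (leq_ltn_trans (max_card _)) // card_bool (ltn_trans _ p_gt4).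
rewrite (subnormal_count_extension h) ?subsetT // im0 addn0.
have -> : ('ker_[set: {perm T}] h)%G = 'Alt_T%G by apply: val_inj; rewrite /= setTI.
apply: subnormal_count_simple => //; apply/eqP => cAp.
move: cA; rewrite cAp; move: p_gt4; clear; case: p => // m; rewrite ltnS => m4.
rewrite factS [(2 * _)%N]mulnC => /eqP; rewrite eqn_pmul2l // => /eqP E.
by have := fact_geq m; rewrite -E leqNgt (leq_trans _ m4).
Qed.

End SubnormalChains.

(** * An index for commensurable subgroups, and a homomorphism on the commensurator *)

Lemma subgroup_ext (G : groupType) (A B : subgroup G) :
  (forall x, carrier A x <-> carrier B x) -> A = B.
Proof.
case: A B => A A1 AM AV [B B1 BM BV] /= AB.
have {}AB : A = B by apply/seteqP; split=> x /AB.
by subst B; congr Subgroup; exact: Prop_irrelevance.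
Qed.

Section FiniteQuotients.
Variables (G : groupType) (Q : finGroupType).
Implicit Types (A B : subgroup G) (f : G -> Q).

Definition morph_on A f :=
  forall x y, carrier A x -> carrier A y -> f (x * y) = f x * f y.

(** Stated with a generated subgroup, this is a group for every f; it is the plain
image of A as soon as f is multiplicative on A. *)
Definition image_group A f : {group Q} :=
  <<[set q | `[< exists2 x, carrier A x & f x = q >]]>>%G.

(** The finite quotient f of A has its kernel inside B, so that f sees the inclusion
of B in A. *)
Definition separates A B f :=
  morph_on A f /\ forall x, carrier A x -> f x = 1 -> carrier B x.

Lemma morph_on1 A f : morph_on A f -> f 1 = 1.
Proof.
move=> fM; have A1 := subgroup1 A; apply: (mulgI (f 1)).
by rewrite -fM // !mulg1.
Qed.

Lemma morph_onV A f x : morph_on A f -> carrier A x -> f x^-1 = (f x)^-1.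
Proof.
move=> fM Ax; apply: (mulgI (f x)); rewrite mulgV -fM ?mulgV ?(morph_on1 fM) //.
exact: subgroupV.
Qed.

Lemma image_groupP A f q : morph_on A f ->
  reflect (exists2 x, carrier A x & f x = q) (q \in image_group A f).
Proof.
move=> fM; set S := [set q | `[< exists2 x, carrier A x & f x = q >]].
have gS : group_set S.
  apply/group_setP; split.
    by rewrite inE; apply/asboolP; exists 1; [exact: subgroup1|exact: morph_on1 fM].
  move=> a b; rewrite !inE => /asboolP[x Ax <-] /asboolP[y Ay <-]; apply/asboolP.
  by exists (x * y); [exact: subgroupM|rewrite fM].
by rewrite /image_group /= (gen_set_id gS) inE; exact: asboolP.
Qed.

Lemma morph_onS A B f : (forall x, carrier B x -> carrier A x) ->
  morph_on A f -> morph_on B f.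
Proof. by move=> sBA fM x y /sBA ? /sBA ?; apply: fM. Qed.

End FiniteQuotients.

Section GeneralizedIndex.
Variable p : nat.
Hypothesis p_pr : prime p.
Variable G : groupType.
Implicit Types A B C D : subgroup G.

Definition quotient_index (Q : finGroupType) A B (f : G -> Q) : int :=
  ((subnormal_count p (image_group A f))%:Z
   - (subnormal_count p (image_group B f))%:Z)%R.

Definition sub_subgroup B A := forall x, carrier B x -> carrier A x.

(** Project the image of A under the pair (f, f') to its first factor and apply
additivity: the kernel K of the projection is the image of ker f under f'. *)
Lemma count_image_pair (Q Q' : finGroupType) A (f : G -> Q) (f' : G -> Q') :
  morph_on A f -> morph_on A f' ->
  let K := [set q : Q * Q' |
    `[< exists x, [/\ carrier A x, f x = 1 & q = (1, f' x) :> Q * Q'] >]] in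
  subnormal_count p (image_group A (fun x => (f x, f' x) : Q * Q')) =
  (subnormal_count p <<K>>%G + subnormal_count p (image_group A f))%N.
Proof.
move=> fM f'M K; pose F x : Q * Q' := (f x, f' x).
have FM : morph_on A F by move=> x y Ax Ay; rewrite /F fM ?f'M.
rewrite (subnormal_count_extension p_pr [morphism of fst]); last exact: subsetT.
have gK : group_set K.
  apply/group_setP; split.
    rewrite inE; apply/asboolP; exists 1.
    by rewrite (morph_on1 fM) (morph_on1 f'M); split=> //; exact: subgroup1.
  move=> a b; rewrite !inE => /asboolP[x [Ax fx ->]] /asboolP[y [Ay fy ->]].
  apply/asboolP; exists (x * y); rewrite fM // fx fy mulg1; split=> //.
    exact: subgroupM.
  by rewrite f'M //; congr pair; rewrite /= mulg1.
congr addn; congr subnormal_count; apply/group_inj/setP => q /=.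
  rewrite (gen_set_id gK) inE; apply/idP/idP.
    rewrite !inE => /andP[/(image_groupP _ FM)[x Ax <-]] /eqP /= fx.
    by apply/asboolP; exists x; split=> //; rewrite /F fx.
  rewrite inE => /asboolP[x [Ax fx ->]].
  rewrite !inE /= eqxx andbT; apply/(image_groupP _ FM).
  by exists x => //; rewrite /F fx.
apply/idP/idP.
  move=> /morphimP[_ _ /(image_groupP _ FM)[x Ax <-] ->].
  by apply/(image_groupP _ fM); exists x.
move=> /(image_groupP _ fM)[x Ax <-]; apply/morphimP; exists (F x) => //.
by apply/(image_groupP _ FM); exists x.
Qed.

(** The kernel of f is the same in A and in B, hence the kernels K of the previous
lemma agree for A and B and cancel in the difference. *)
Lemma quotient_index_pair (Q Q' : finGroupType) A B (f : G -> Q) (f' : G -> Q') :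
  sub_subgroup B A -> separates A B f -> morph_on A f' ->
  quotient_index A B f = quotient_index A B (fun x => (f x, f' x) : Q * Q').
Proof.
move=> sBA [fM fB] f'M; have [fMB f'MB] := (morph_onS sBA fM, morph_onS sBA f'M).
rewrite /quotient_index !count_image_pair //.
set K := <<_>>%G; set L := <<_>>%G; suff -> : K = L.
  by rewrite !PoszD GRing.opprD GRing.addrACA GRing.subrr GRing.add0r.
apply/group_inj; congr <<_>>; apply/setP => q; rewrite !inE.
apply/asboolP/asboolP => -[x [Ax fx ->]]; exists x; split=> //.
  exact: fB.
exact: sBA.
Qed.

Lemma quotient_index_inj (Q Q' : finGroupType) A B (f : G -> Q)
    (h : {morphism [set: Q] >-> Q'}) :
  'injm h -> morph_on A f -> morph_on B f ->
  quotient_index A B f = quotient_index A B (h \o f).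
Proof.
move=> injh fMA fMB; suff E C : morph_on C f ->
    subnormal_count p (image_group C f) = subnormal_count p (image_group C (h \o f)).
  by rewrite /quotient_index !E.
move=> fM; have hfM : morph_on C (h \o f).
  by move=> x y Cx Cy; rewrite /= fM // morphM ?inE.
rewrite (subnormal_count_extension p_pr h); last exact: subsetT.
have -> : ('ker_(image_group C f) h)%G = 1%G.
  by apply: val_inj; rewrite /= (trivgP injh); apply/setIidPr; rewrite sub1G.
rewrite [X in (X + _)%N]subnormal_count_p'group // ?add0n; last first.
  by rewrite cards1 dvdn1; case: eqP p_pr => // ->.
congr subnormal_count; apply/group_inj/setP => q; apply/idP/idP.
  move=> /morphimP[_ _ /(image_groupP _ fM)[x Cx <-] ->].
  by apply/(image_groupP _ hfM); exists x.
move=> /(image_groupP _ hfM)[x Cx <-]; apply/morphimP; exists (f x); rewrite ?inE //.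
by apply/(image_groupP _ fM); exists x.
Qed.

(** Both sides equal the index computed with the pair (f, f'), up to the exchange of
the two factors. *)
Lemma quotient_index_indep (Q Q' : finGroupType) A B (f : G -> Q) (f' : G -> Q') :
  sub_subgroup B A -> separates A B f -> separates A B f' ->
  quotient_index A B f = quotient_index A B f'.
Proof.
move=> sBA sf sf'; have [[fM _] [f'M _]] := (sf, sf').
rewrite (quotient_index_pair sBA sf f'M) (quotient_index_pair sBA sf' fM).
pose swap (x : Q * Q') : Q' * Q := (x.2, x.1).
have swapM : {in [set: Q * Q'] &, {morph swap : x y / x * y}} by [].
have -> : (fun x => (f' x, f x)) = Morphism swapM \o (fun x => (f x, f' x)) by [].
have pM : morph_on A (fun x => (f x, f' x) : Q * Q').
  by move=> x y Ax Ay; rewrite fM ?f'M.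
apply: quotient_index_inj => //; last exact: morph_onS pM.
by apply/injmP => -[x y] [z t] _ _ [-> ->].
Qed.

Definition separable A B :=
  exists (Q : finGroupType) (f : G -> Q), separates A B f.

(** The action of A by left translation on the finite set of cosets xB, with x in A;
an element that fixes the coset B lies in B. *)
Lemma separable_few_cosets A B : sub_subgroup B A -> few_cosets A B -> separable A B.
Proof.
move=> sBA fAB.
have fin : finite_index B A.
  apply/(@finite_indexP _ A B B) => // x; split=> [Bx|[]//].
  by split=> //; exact: sBA.
have /finite_seqP[s sE] := fin.
have sP c : (c \in s) <-> exists2 x, carrier A x & \pi_(coset_space B) x = c.
  have -> : (c \in s) = [set` s]%classic c :> Prop by [].
  by rewrite -sE.
have As x t : carrier A x -> t \in s ->
    \pi_(coset_space B) (x * generic_quotient.repr t) \in s.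
  move=> Ax /sP[y Ay <-]; apply/sP; exists (x * y); first exact: subgroupM.
  apply/coset_eqP; rewrite invgM -mulgA mulKg; apply/coset_eqP.
  by rewrite reprK.
pose act x (t : seq_sub s) : seq_sub s :=
  insubd t (\pi_(coset_space B) (x * generic_quotient.repr (val t))).
have actE x t : carrier A x ->
    val (act x t) = \pi_(coset_space B) (x * generic_quotient.repr (val t)).
  by move=> Ax; rewrite val_insubd As //; exact: valP.
have actM x y t : carrier A x -> carrier A y -> act (x * y) t = act x (act y t).
  move=> Ax Ay; apply: val_inj; rewrite !actE //; last exact: subgroupM.
  apply/coset_eqP; rewrite !invgM -!mulgA mulKg mulgA -invgM; apply/coset_eqP.
  by rewrite reprK.
have act1 t : act 1 t = t.
  by apply: val_inj; rewrite actE ?mul1g ?reprK //; exact: subgroup1.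
have act_inj x : injective (act (if `[< carrier A x >] then x else 1)).
  case: asboolP => [Ax|_] t u; last by rewrite !act1.
  have AxV := subgroupV Ax.
  by move=> /(congr1 (act x^-1)); rewrite -!actM // mulVg !act1.
(* Products of permutations are read from left to right and translations act from
   the left, hence the inverse. *)
exists {perm (seq_sub s)}, (fun x => (perm (@act_inj x))^-1); split.
  move=> x y Ax Ay; apply/invg_inj; rewrite invgM !invgK; apply/permP => t.
  rewrite permE permM !permE !asboolT ?actM //; exact: subgroupM.
move=> x Ax /(congr1 (fun u : {perm _} => u^-1)); rewrite invgK invg1 => /permP.
have s1 : \pi_(coset_space B) 1 \in s by apply/sP; exists 1 => //; exact: subgroup1.
move=> /(_ (SeqSub s1)); rewrite permE perm1 asboolT // => /(congr1 val).
rewrite actE //= => /coset_eqP; set r := generic_quotient.repr _ => h.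
have : carrier B (1^-1 * r) by apply/coset_eqP; rewrite /r reprK.
rewrite invg1 mul1g => Br; move: h; rewrite mulg1 invgM => h.
by have /subgroupV := subgroupM Br h; rewrite mulKVg invgK.
Qed.

(** The difference m_p(A/K) - m_p(B/K) for any normal subgroup K of finite index of A
contained in B. The value 0 when there is none is a placeholder. *)
Definition gen_index A B : int :=
  if pselect (separable A B) is left sep then
    quotient_index A B (projT1 (cid (projT2 (cid sep))))
  else 0%R.

Lemma gen_indexE (Q : finGroupType) A B (f : G -> Q) :
  sub_subgroup B A -> separates A B f -> gen_index A B = quotient_index A B f.
Proof.
move=> sBA sf; rewrite /gen_index; case: pselect => [sep|[]]; last by exists Q, f.
apply: quotient_index_indep => //; exact: projT2 (cid (projT2 (cid sep))).
Qed.

(** A quotient of A with kernel inside C computes all three indices. *)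
Lemma gen_index_add A B C : sub_subgroup B A -> sub_subgroup C B -> few_cosets A C ->
  gen_index A C = (gen_index A B + gen_index B C)%R.
Proof.
move=> sBA sCB fAC; have sCA : sub_subgroup C A by move=> x /sCB/sBA.
have [Q [f [fM fC]]] := separable_few_cosets sCA fAC.
rewrite !(gen_indexE (f := f)) //.
- by rewrite /quotient_index GRing.addrA GRing.subrK.
- by split; [exact: morph_onS fM|move=> x /sBA; exact: fC].
- by split=> // x Ax fx; apply/sCB/fC.
Qed.

Lemma gen_indexJ g A B : sub_subgroup B A -> few_cosets A B ->
  gen_index (conj_subgroup g A) (conj_subgroup g B) = gen_index A B.
Proof.
move=> sBA fAB; have [Q [f [fM fB]]] := separable_few_cosets sBA fAB.
pose f' x := f (g^-1 * x * g).
have f'E x : f' (g * x * g^-1) = f x by rewrite /f' !mulgA mulVg mul1g mulgVK.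
have f'M : morph_on (conj_subgroup g A) f'.
  move=> _ _ [x Ax <-] [y Ay <-]; rewrite !f'E -fM // -f'E; congr f'.
  by rewrite !mulgA mulgVK.
have sgBA : sub_subgroup (conj_subgroup g B) (conj_subgroup g A).
  by move=> _ [x /sBA Ax <-]; exists x.
rewrite (@gen_indexE _ A B f) // (@gen_indexE _ _ _ f') //; last first.
  by split=> // _ [x Ax <-]; rewrite f'E => fx; exists x => //; exact: fB.
have E C : sub_subgroup C A -> image_group (conj_subgroup g C) f' = image_group C f.
  move=> sCA; apply/group_inj; congr <<_>>; apply/setP => q; rewrite !inE.
  apply/asboolP/asboolP => [[_ [x Cx <-] <-]|[x Cx <-]].
    by exists x; rewrite // f'E.
  by exists (g * x * g^-1); rewrite ?f'E //; exists x.
by rewrite /quotient_index !E.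
Qed.

Lemma few_cosetsI A B : few_cosets A B -> few_cosets A (subgroupI A B).
Proof.
have AB x : carrier (subgroupI A B) x <-> carrier A x /\ carrier B x by [].
move=> /(finite_indexP AB) fAB; apply/(finite_indexP (L := subgroupI A B)) => //.
by move=> x; split=> [[]|[]].
Qed.

Lemma few_cosetsS A B C : sub_subgroup B A -> few_cosets A C -> few_cosets B C.
Proof. by move=> sBA [S fS cS]; exists S => // x /sBA/cS. Qed.

(** The extension of the index to commensurable pairs that keeps it additive, in the
way [A : A n B] / [B : A n B] extends the usual index. *)
Definition rel_index A B : int :=
  (gen_index A (subgroupI A B) - gen_index B (subgroupI A B))%R.

(** Every common subgroup D of finite index gives the same value, since the
contribution of D inside the intersection cancels. *)
Lemma rel_indexE A B D : sub_subgroup D A -> sub_subgroup D B ->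
  few_cosets A D -> few_cosets B D ->
  rel_index A B = (gen_index A D - gen_index B D)%R.
Proof.
move=> sDA sDB fAD fBD; have sD : sub_subgroup D (subgroupI A B).
  by move=> x Dx; split; [exact: sDA|exact: sDB].
rewrite (@gen_index_add A (subgroupI A B)) //; last by move=> x [].
rewrite (@gen_index_add B (subgroupI A B)) //; last by move=> x [].
by rewrite GRing.opprD GRing.addrACA GRing.subrr GRing.addr0.
Qed.

Lemma rel_index_add A B C : commensurable A B -> commensurable B C ->
  rel_index A C = (rel_index A B + rel_index B C)%R.
Proof.
move=> /commensurableP[AB BA] /commensurableP[BC CB].
pose D := subgroupI (subgroupI A B) C.
have fBD : few_cosets B D.
  apply: few_cosets_trans (few_cosetsI _).
    apply: (few_cosets_trans (few_cosetsI BA)); exists [set 1%g]%classic => // x [Bx Ax].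
    by exists 1 => //; rewrite invg1 mul1g.
  by apply: few_cosetsS BC => x [].
have fAD := few_cosets_trans AB fBD; have fCD := few_cosets_trans CB fBD.
rewrite !(@rel_indexE _ _ D) //; try by move=> x [[]].
by rewrite GRing.addrA GRing.subrK.
Qed.

Lemma rel_indexJ g A B : commensurable A B ->
  rel_index (conj_subgroup g A) (conj_subgroup g B) = rel_index A B.
Proof.
move=> /commensurableP[AB BA].
have fA := few_cosetsI AB.
have fB : few_cosets B (subgroupI A B).
  rewrite (_ : subgroupI A B = subgroupI B A); first exact: few_cosetsI.
  by apply: subgroup_ext => x; split=> -[].
rewrite (@rel_indexE _ _ (conj_subgroup g (subgroupI A B))).
- by rewrite !gen_indexJ // => x [].
- by move=> _ [x [Ax Bx] <-]; exists x.
- by move=> _ [x [Ax Bx] <-]; exists x.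
- exact: few_cosetsJ.
- exact: few_cosetsJ.
Qed.

Lemma conj_subgroupM g h A :
  conj_subgroup (g * h) A = conj_subgroup g (conj_subgroup h A).
Proof.
apply: subgroup_ext => x; split.
  by move=> [y Ay <-]; exists (h * y * h^-1); [exists y|rewrite invgM !mulgA].
by move=> [_ [y Ay <-] <-]; exists y; rewrite // invgM !mulgA.
Qed.

Lemma commensurableJ g A B : commensurable A B ->
  commensurable (conj_subgroup g A) (conj_subgroup g B).
Proof.
by move=> /commensurableP[AB BA]; apply/commensurableP; split; exact: few_cosetsJ.
Qed.

(** An analogue of the modular function for the commensurated subgroup A, with the
multiplicity of Z/p in place of the logarithm of the index. *)
Definition comm_hom A g : int := rel_index A (conj_subgroup g A).

Lemma comm_homM A g h : carrier (commensurator A) g -> carrier (commensurator A) h ->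
  comm_hom A (g * h) = (comm_hom A g + comm_hom A h)%R.
Proof.
move=> Cg Ch; rewrite /comm_hom conj_subgroupM.
by rewrite (rel_index_add Cg (commensurableJ g Ch)) rel_indexJ.
Qed.

End GeneralizedIndex.

(** Two finite quotients, of A and of its conjugate, compute the value for all primes
p at once, and groups of order less than p have no composition factor of order p. *)
Lemma comm_hom_bounded (G : groupType) (A : subgroup G) g :
  carrier (commensurator A) g ->
  exists b, forall p, prime p -> (b < p)%N -> comm_hom p A g = 0%R.
Proof.
move=> /commensurableP[fAB fBA]; set B := conj_subgroup g A in fAB fBA.
pose D := subgroupI A B.
have fA : few_cosets A D := few_cosetsI fAB.
have fB : few_cosets B D.
  rewrite (_ : D = subgroupI B A); first exact: few_cosetsI.
  by apply: subgroup_ext => x; split=> -[].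
have sA : sub_subgroup D A by move=> x [].
have sB : sub_subgroup D B by move=> x [].
have [Q [f sf]] := separable_few_cosets sA fA.
have [R [h sh]] := separable_few_cosets sB fB.
exists (#|Q| + #|R|)%N => p p_pr lt_p.
rewrite /comm_hom -/B /rel_index (gen_indexE p_pr sA sf) (gen_indexE p_pr sB sh).
have count0 (X : finGroupType) (Y : {group X}) : (#|X| < p)%N -> subnormal_count p Y = 0.
  move=> ltXp; apply: subnormal_count_p'group => //; apply/negP.
  move=> /(dvdn_leq (cardG_gt0 _)); apply/negP; rewrite -ltnNge.
  exact: leq_ltn_trans (max_card _) ltXp.
rewrite /quotient_index !count0 ?GRing.subrr //;
  by rewrite (leq_ltn_trans _ lt_p) ?leq_addl ?leq_addr.
Qed.

(** * Legal edge colourings of regular trees *)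

Section Walks.
Variables (I : eqType) (X : Type) (M : I -> X -> X).

Definition walk x w := foldl (fun y i => M i y) x w.

Lemma walk_cat x w1 w2 : walk x (w1 ++ w2) = walk (walk x w1) w2.
Proof. exact: foldl_cat. Qed.

Hypothesis MK : forall i, involutive (M i).

Lemma walk_rev x w : walk (walk x w) (rev w) = x.
Proof.
elim/last_ind: w x => [|w i IH] x //.
by rewrite rev_rcons -cats1 walk_cat /= MK IH.
Qed.

(** The rewriting rule of the free product of groups of order 2. *)
Lemma walk_backtrack x p i q : walk x (p ++ i :: i :: q) = walk x (p ++ q).
Proof. by rewrite !walk_cat /= MK. Qed.

End Walks.

Definition reduced_word (I : eqType) (w : seq I) := sorted (fun i j => i != j) w.

Lemma not_reduced_word (I : eqType) (w : seq I) : ~~ reduced_word w ->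
  exists p i q, w = p ++ i :: i :: q.
Proof.
elim: w => [|i [|j w] IH] //=; rewrite negb_and negbK => /orP[/eqP->|/IH].
  by exists [::], j, w.
by move=> [p [k [q ->]]]; exists (i :: p), k, q.
Qed.

Lemma reduced_word_infix (I : eqType) (w : seq I) i j : reduced_word w ->
  reduced_word (drop i (take j w)).
Proof. by move=> /(take_sorted j)/(drop_sorted i). Qed.

Section FrameSystems.
Variables (V : choiceType) (T : rel V) (d : nat).
Hypothesis T_tree : is_tree T.

(** A way to read T in local coordinates: every x of X sits over the vertex pi x and
names the d edges at pi x by colours, and M i moves to the other end of the
edge of colour i. Legal edge colourings are the case where pi is the identity. Systems
with larger fibres are used as reservoirs out of which colourings are extracted. *)
Record frame_system (X : Type) (pi : X -> V) (M : 'I_d -> X -> X) : Prop := FrameSystem {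
  frameK : forall i, involutive (M i);
  frame_adj : forall x i, T (pi x) (pi (M i x));
  frame_inj : forall x, injective (fun i => pi (M i x));
  frame_surj : forall x w, T (pi x) w -> exists i, w = pi (M i x) }.

Lemma path_iota (g : nat -> V) a m :
  (forall k, (a <= k < a + m)%N -> T (g k) (g k.+1)) ->
  path T (g a) [seq g k | k <- iota a.+1 m].
Proof.
elim: m a => //= m IH a h; rewrite h ?leqnn ?addnS ?ltnS ?leq_addr //=.
by apply: IH => k /andP[ak kam]; apply: h; rewrite ltnW //= -addSnnS.
Qed.

Section OneSystem.
Variables (X : Type) (pi : X -> V) (M : 'I_d -> X -> X).
Hypothesis fsM : frame_system pi M.
Let MK := frameK fsM.

(** A reduced closed walk of least length has no repeated vertex, hence it is a cycle of
the tree; acyclicity leaves lengths 1 and 2, excluded by the absence of loops and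
by reducedness. *)
Lemma reduced_word_open w x : reduced_word w -> w != [::] -> pi (walk M x w) <> pi x.
Proof.
move: {2}(size w) (leqnn (size w)) => m.
elim: m w x => [|m IH] w x; first by rewrite leqn0 size_eq0 => ->.
move=> sw rw w0 closed.
pose g k := pi (walk M x (take k w)).
have g0 : g 0 = pi x by rewrite /g take0.
have gs : g (size w) = pi x by rewrite /g take_size.
have gT k : (k < size w)%N -> T (g k) (g k.+1).
  rewrite /g; case: (w) => // a w' kw.
  by rewrite (take_nth a kw) -cats1 walk_cat /=; exact: (frame_adj fsM).
(* A repeated vertex would bound a shorter closed reduced word. *)
have g_inj i j : (i < j)%N -> (j < size w)%N -> g i <> g j.
  move=> ij jw gij; pose u := drop i (take j w).
  have tu : take j w = take i w ++ u.
    by rewrite /u -{1}(cat_take_drop i (take j w)) take_takel // ltnW.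
  apply: (IH u (walk M x (take i w))).
  - rewrite size_drop size_take jw leq_subLR.
    by rewrite (leq_trans _ (leq_addl _ _)) // -ltnS (leq_trans jw).
  - exact: reduced_word_infix.
  - by rewrite -size_eq0 size_drop size_take jw subn_eq0 -ltnNge.
  - by rewrite -walk_cat -tu; exact/esym.
have s_gt0 : (0 < size w)%N by rewrite lt0n size_eq0.
pose c := [seq g k | k <- iota 0 (size w)].
have cyc : path.cycle T c.
  have -> : c = g 0 :: [seq g k | k <- iota 1 (size w).-1] by rewrite /c -{1}(prednK s_gt0).
  rewrite [path.cycle _ _]/= [X in rcons _ X]g0 -gs.
  have <- : [seq g k | k <- iota 1 (size w)] =
      rcons [seq g k | k <- iota 1 (size w).-1] (g (size w)).
    case: (size w) s_gt0 => // k _; rewrite [k.+1.-1]/= -cats1.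
    by rewrite -(addn1 k) iotaD map_cat add1n addn1.
  by apply: path_iota => k /andP[_]; exact: gT.
have uc : uniq c.
  rewrite map_inj_in_uniq ?iota_uniq // => i j; rewrite !mem_iota !add0n /= => iw jw gij.
  by case: (ltngtP i j) => // ij; [case: (g_inj i j)|case: (g_inj j i)].
have := tree_acyclic T_tree (c := c); rewrite /ucycle cyc uc => /(_ isT).
rewrite size_map size_iota.
case: w rw w0 closed {sw g g0 gs gT g_inj s_gt0 c cyc uc}
  => [|a [|b [|? ?]]] //= rw _ closed _.
  by have := frame_adj fsM x a; rewrite closed (tree_irr T_tree).
move: rw; rewrite /reduced_word /= andbT => /eqP; apply.
by apply/esym/(frame_inj fsM (x := M a x)); rewrite /= closed MK.
Qed.

(** A word that closes up in the tree is not reduced, so it can be shortened by the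
cancellation rule, which is valid for every family of involutions. *)
Lemma closed_walk u x : pi (walk M x u) = pi x ->
  forall (Y : Type) (b : 'I_d -> Y -> Y), (forall i, involutive (b i)) ->
  forall y, walk b y u = y.
Proof.
move: {2}(size u) (leqnn (size u)) => m.
elim: m u x => [|m IH] u x; first by rewrite leqn0 size_eq0 => /eqP->.
move=> su cu Y b bK y; have [->//|u0] := eqVneq u [::].
have [ru|/not_reduced_word[p [i [q uE]]]] := boolP (reduced_word u).
  by case: (reduced_word_open ru u0 cu).
move: cu su; rewrite uE !walk_backtrack // => cu su; apply: IH cu _ _ bK _.
by move: su; rewrite !size_cat /= !addnS ltnS => /ltnW.
Qed.

(** The orbits of the moves M over the tree are torsors under the free product of d
groups of order 2: what holds there holds for all families of d involutions. *)
Lemma walk_universal x w1 w2 : pi (walk M x w1) = pi (walk M x w2) ->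
  forall (Y : Type) (b : 'I_d -> Y -> Y), (forall i, involutive (b i)) ->
  forall y, walk b y w1 = walk b y w2.
Proof.
move=> e Y b bK y; have := @closed_walk (rev w1 ++ w2) (walk M x w1).
rewrite walk_cat walk_rev // -e => /(_ erefl _ b bK (walk b y w1)).
by rewrite walk_cat walk_rev.
Qed.

Lemma walk_connected x v : exists w, pi (walk M x w) = v.
Proof.
have [p] := tree_connected T_tree (pi x) v; elim: p x => [|u p IH] x /=.
  by move=> _ <-; exists [::].
move=> /andP[/(frame_surj fsM)[i ->] Tp] l; have [w <-] := IH _ Tp l.
by exists (i :: w).
Qed.

(** The orbit of x0 under the moves meets every fibre exactly once: at least once since
the tree is connected, at most once by the universal property. It is therefore a
section, and reading the colours along it gives a legal colouring. *)
Lemma frame_section x0 : exists s : V -> X,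
  [/\ forall v, pi (s v) = v, s (pi x0) = x0,
      forall i v, s (pi (M i (s v))) = M i (s v) &
      frame_system id (fun i v => pi (M i (s v)))].
Proof.
pose word v := projT1 (cid (walk_connected x0 v)).
have wordE v : pi (walk M x0 (word v)) = v by rewrite /word; case: cid.
pose s v := walk M x0 (word v).
have sE w : s (pi (walk M x0 w)) = walk M x0 w.
  by apply: (walk_universal (x := x0)) => //; exact: wordE.
have sM i v : s (pi (M i (s v))) = M i (s v).
  by have := sE (rcons (word v) i); rewrite -cats1 walk_cat.
exists s; split=> //; first exact: (sE [::]).
split=> [i v|v i|v i j|v w] //=.
- by rewrite sM MK; exact: wordE.
- by rewrite -{1}(wordE v); exact: (frame_adj fsM).
- by move=> e; exact: (frame_inj fsM) e.
- by move=> Tvw; apply: (frame_surj fsM); rewrite [pi _]wordE.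
Qed.

End OneSystem.

Notation legal_coloring := (frame_system (@id V)).

Section Colorings.
Variable n : 'I_d -> V -> V.
Hypothesis ln : legal_coloring n.

(** The universal property in the form in which it is used: V is the regular torsor,
so an equivariant map exists from it to every family of involutions. *)
Lemma equivariant_map (Y : Type) (b : 'I_d -> Y -> Y) :
  (forall i, involutive (b i)) -> forall v0 y0,
  exists q : V -> Y, q v0 = y0 /\ forall i v, q (n i v) = b i (q v).
Proof.
move=> bK v0 y0; pose word v := projT1 (cid (walk_connected ln v0 v)).
have wordE v : walk n v0 (word v) = v by rewrite /word; case: cid.
pose q v := walk b y0 (word v).
have qE w : q (walk n v0 w) = walk b y0 w.
  by apply: (walk_universal ln (x := v0)) => //; exact: wordE.
exists q; split=> [|i v]; first exact: (qE [::]).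
by rewrite -{1}(wordE v); have := qE (rcons (word v) i); rewrite -cats1 !walk_cat.
Qed.

Lemma equivariant_unique (Y : Type) (b : 'I_d -> Y -> Y) (q q' : V -> Y) v0 :
  (forall i v, q (n i v) = b i (q v)) -> (forall i v, q' (n i v) = b i (q' v)) ->
  q v0 = q' v0 -> q =1 q'.
Proof.
move=> qE q'E q0 v; have [w <-] := walk_connected ln v0 v.
elim/last_ind: w => [|w i IH] //.
by rewrite -cats1 walk_cat /= qE q'E; congr b.
Qed.

End Colorings.

Lemma coloring_adj n v w : legal_coloring n -> T v w <-> exists i, w = n i v.
Proof.
by move=> ln; split=> [/(frame_surj ln)|[i ->]] //; exact: (frame_adj ln).
Qed.

Lemma coloring_transport n n' : legal_coloring n -> legal_coloring n' ->
  forall v v', exists g : graph_aut T, g v = v' /\ forall i u, g (n i u) = n' i (g u).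
Proof.
move=> ln ln' v v'.
have [g [gv gn]] := equivariant_map ln (frameK ln') v v'.
have [h [hv hn]] := equivariant_map ln' (frameK ln) v' v.
have hg : cancel g h.
  apply: (equivariant_unique ln (q := h \o g) (q' := id) (b := n) (v0 := v)) => //=.
    by move=> i u; rewrite gn hn.
  by rewrite gv hv.
have gh : cancel h g.
  apply: (equivariant_unique ln' (q := g \o h) (q' := id) (b := n') (v0 := v')) => //=.
    by move=> i u; rewrite hn gn.
  by rewrite hv gv.
have gP : is_automorphism T g.
  split=> [|u w]; first by exists h.
  apply/idP/idP => /coloring_adj.
    move=> /(_ _ ln')[i e]; apply/(coloring_adj _ _ ln); exists i.
    by rewrite -[w]hg e hn hg.
  by move=> /(_ _ ln)[i ->]; apply/(coloring_adj _ _ ln'); exists i.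
by exists (GraphAut (introT (asboolP _) gP)).
Qed.

(** Name the neighbours of each vertex v arbitrarily by nu v. The reservoir consists of
all relabellings (v, s) of these names; crossing an edge with names a and b at its two
ends, compose the relabelling with the transposition of a and b, which is
an involutive rule that keeps the colour of the edge. *)
Lemma coloring_exists : (0 < d)%N -> regular_graph T d -> exists n, legal_coloring n.
Proof.
move=> d_gt0 Treg.
have exnu v : exists nu : 'I_d -> V, [/\ injective nu, forall i, T v (nu i) &
    forall w, T v w -> exists i, w = nu i].
  have /card_esym/card_bijP[f [g fK gK]] := Treg v.
  pose o (i : 'I_d) : classical_sets.set_type (`I_d)%classic :=
    exist _ (val i) (mem_set (ltn_ord i)).
  exists (fun i => val (f (o i))); split.
  - move=> i j /val_inj/(can_inj fK)/(congr1 val) /=; exact: val_inj.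
  - by move=> i; exact: set_mem (valP (f (o i))).
  - move=> w Tvw; pose k := g (exist _ w (mem_set Tvw)).
    exists (Ordinal (set_mem (valP k))).
    by rewrite (_ : o _ = k) ?gK //; exact: val_inj.
pose nu v := projT1 (cid (exnu v)).
have nu_inj v : injective (nu v) by rewrite /nu; case: cid => ? [].
have nuT v i : T v (nu v i) by rewrite /nu; case: cid => ? [].
have exidx v w : exists i, T v w -> nu v i = w.
  have [Tvw|nTvw] := boolP (T v w).
    by rewrite /nu; case: cid => f [_ _ /= /(_ _ Tvw)[i ->]]; exists i.
  by exists (Ordinal d_gt0).
pose idx v w := projT1 (cid (exidx v w)).
have idxE v w : T v w -> nu v (idx v w) = w by rewrite /idx; case: cid.
have idxK v i : idx v (nu v i) = i by apply: (nu_inj v); exact: idxE.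
pose M i (x : V * {perm 'I_d}) :=
  let w := nu x.1 (x.2 i) in (w, x.2 * tperm (x.2 i) (idx w x.1)).
have fsM : frame_system (fun x : V * {perm 'I_d} => x.1) M.
  split=> [i [v s]|[v s] i|[v s] i j /nu_inj/perm_inj//|[v s] w /= Tvw].
  - rewrite /M /= permM tpermL; set w := nu v (s i).
    have Twv : T w v by rewrite (tree_sym T_tree) nuT.
    by rewrite idxE // idxK [tperm _ (s i)]tpermC -mulgA tperm2 mulg1.
  - exact: nuT.
  - by exists (s^-1 (idx v w)); rewrite permKV idxE.
have [v _] := tree_inhabited T_tree.
have [s [_ _ _ ls]] := frame_section fsM (v, 1).
by eexists; exact: ls.
Qed.

End FrameSystems.

Notation legal_coloring T n := (frame_system T id n).

(** * Monodromy of the automorphisms of a colouring *)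

(** Stabilisers are shown to have finite index by exhibiting such an invariant h. *)
Lemma few_cosets_fun (G : groupType) (A B : subgroup G) (Y : Type) (h : G -> Y) :
  finite_set (h @` carrier A)%classic ->
  (forall x y, carrier A x -> carrier A y -> h x = h y -> carrier B (x^-1 * y)) ->
  few_cosets A B.
Proof.
move=> fin hB.
pose c y := xget 1 [set x | carrier A x /\ h x = y]%classic.
exists (c @` (h @` carrier A))%classic; first exact: finite_image.
move=> x Ax; exists (c (h x)); first by exists (h x) => //; exists x.
have [Ac hc] : carrier A (c (h x)) /\ h (c (h x)) = h x.
  by apply: (@xgetPex _ 1 [set z | carrier A z /\ h z = h x]%classic); exists x.
exact: hB.
Qed.

Lemma separates_few_cosets (G : groupType) (Q : finGroupType) (A B : subgroup G)
    (f : G -> Q) :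
  separates A B f -> few_cosets A B.
Proof.
move=> [fM fB]; apply: (few_cosets_fun (h := f)); first exact: finite_finset.
move=> x y Ax Ay fxy; have AxV := subgroupV Ax.
by apply: fB; [exact: subgroupM|rewrite fM // (morph_onV fM) // fxy mulVg].
Qed.

Section ColoringGroups.
Variables (V : choiceType) (T : rel V) (d : nat).
Hypothesis T_tree : is_tree T.

Program Definition coloring_aut (n : 'I_d -> V -> V) : subgroup (graph_aut T) :=
  @Subgroup _ [set g : graph_aut T | forall i v, g (n i v) = n i (g v)]%classic _ _ _.
Next Obligation. by []. Qed.
Next Obligation. by move=> n g h /= gn hn i v; rewrite /= hn gn. Qed.
Next Obligation.
move=> n g /= gn i v; have [gK Kg _] := inv_funP g.
by apply: (can_inj gK); rewrite Kg gn Kg.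
Qed.

Program Definition fiber_stab (Y : Type) (q : V -> Y) : subgroup (graph_aut T) :=
  @Subgroup _ [set g : graph_aut T | forall v, q (g v) = q v]%classic _ _ _.
Next Obligation. by []. Qed.
Next Obligation. by move=> Y q g h /= gq hq v; rewrite /= gq hq. Qed.
Next Obligation.
by move=> Y q g /= gq v; have [_ Kg _] := inv_funP g; rewrite -[in RHS](Kg v) gq.
Qed.

Section Monodromy.
Variables (Y : finType) (n : 'I_d -> V -> V) (b : 'I_d -> {perm Y}) (q : V -> Y) (v0 : V).
Hypothesis ln : legal_coloring T n.
Hypothesis bK : forall i, b i * b i = 1.
Hypothesis qE : forall i v, q (n i v) = b i (q v).

Let bKf i : involutive (b i).
Proof. by move=> y; rewrite -permM bK perm1. Qed.

Definition word_to v := projT1 (cid (walk_connected T_tree ln v0 v)).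

Lemma word_toE v : walk n v0 (word_to v) = v.
Proof. by rewrite /word_to; case: cid. Qed.

(** The automorphism g is encoded by the word that leads from v0 to g v0, and this
word acts on Y. Since g preserves colours, the word of a product of automorphisms is the
concatenation of their words, and permutations compose from left to right. *)
Definition monodromy (g : graph_aut T) : {perm Y} := \prod_(i <- word_to (g v0)) b i.

Lemma prod_walk w y : (\prod_(i <- w) b i) y = walk (fun i => b i) y w.
Proof.
elim: w y => [|i w IH] y; first by rewrite big_nil perm1.
by rewrite big_cons permM IH.
Qed.

Lemma monodromyE (g : graph_aut T) w :
  walk n v0 w = g v0 -> monodromy g = \prod_(i <- w) b i.
Proof.
move=> wg; apply/permP => y; rewrite !prod_walk.
by apply: (walk_universal T_tree ln (x := v0)) => //=; rewrite word_toE.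
Qed.

Lemma equivariant_walk (g : graph_aut T) v w : carrier (coloring_aut n) g ->
  g (walk n v w) = walk n (g v) w.
Proof.
move=> gn; elim/last_ind: w => [|w i IH] //.
by rewrite -cats1 !walk_cat /= gn IH.
Qed.

Lemma q_walk v w : q (walk n v w) = walk (fun i => b i) (q v) w.
Proof.
elim/last_ind: w => [|w i IH] //.
by rewrite -cats1 !walk_cat /= qE IH.
Qed.

Lemma monodromyM : morph_on (coloring_aut n) monodromy.
Proof.
move=> g h gn hn; rewrite (@monodromyE (g * h) (word_to (g v0) ++ word_to (h v0))).
  by rewrite big_cat.
by rewrite walk_cat word_toE -equivariant_walk // word_toE.
Qed.

(** Two equivariant maps q and q o g agree as soon as they agree at v0. *)
Lemma monodromy_fiber (g : graph_aut T) : carrier (coloring_aut n) g ->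
  monodromy g (q v0) = q v0 <-> carrier (fiber_stab q) g.
Proof.
move=> gn; have -> : monodromy g (q v0) = q (g v0).
  by rewrite /monodromy prod_walk -q_walk word_toE.
split=> [g0 v|]; last exact.
apply: (equivariant_unique T_tree ln (q := q \o g) (b := fun i => b i) (v0 := v0)) => //.
by move=> i u /=; rewrite gn qE.
Qed.

Lemma monodromy_separates :
  separates (coloring_aut n) (subgroupI (coloring_aut n) (fiber_stab q)) monodromy.
Proof.
split; first exact: monodromyM.
by move=> g gn g1; split=> //; apply/monodromy_fiber => //; rewrite g1 perm1.
Qed.

Lemma image_monodromy :
  image_group (coloring_aut n) monodromy = <<[set b i | i in 'I_d]>>%G.
Proof.
apply/group_inj/eqP; rewrite eqEsubset; apply/andP; split; last first.
  rewrite gen_subG; apply/subsetP => _ /imsetP[i _ ->].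
  apply/(image_groupP _ monodromyM).
  have [g [gv gn]] := coloring_transport T_tree ln ln v0 (n i v0).
  by exists g => //; rewrite (@monodromyE g [:: i]) ?big_seq1.
apply/subsetP => s /(image_groupP _ monodromyM)[g _ <-].
by rewrite group_prod // => i _; apply/mem_gen/imset_f.
Qed.

Lemma image_fiber_stab :
  image_group (subgroupI (coloring_aut n) (fiber_stab q)) monodromy
    \subset perm.Sym [set~ q v0].
Proof.
have fM : morph_on (subgroupI (coloring_aut n) (fiber_stab q)) monodromy.
  by apply: morph_onS monodromyM => x [].
apply/subsetP => s /(image_groupP _ fM)[g [gn gq] <-]; rewrite inE.
apply/subsetP => y; rewrite !inE; apply: contra => /eqP ->.
by apply/eqP/monodromy_fiber.
Qed.

End Monodromy.
End ColoringGroups.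

(** * Recolouring along a finite quotient *)

(** A new colouring is obtained by permuting the colours at v by sw (q v), in the way
prescribed by a finite quotient q of the colouring. The condition [sw_edge] says that the
two ends of an edge receive the same new colour. *)
Section Recoloring.
Variables (V : choiceType) (T : rel V) (d : nat).
Variables (Y : Type) (n : 'I_d -> V -> V) (a : 'I_d -> Y -> Y) (q : V -> Y).
Variable sw : Y -> 'I_d -> 'I_d.
Hypothesis ln : legal_coloring T n.
Hypothesis qE : forall i v, q (n i v) = a i (q v).
Hypothesis swK : forall y, involutive (sw y).
Hypothesis sw_edge : forall y i, sw (a (sw y i) y) i = sw y i.

Definition recoloring (i : 'I_d) v := n (sw (q v) i) v.

Lemma recoloring_legal : legal_coloring T recoloring.
Proof.
split=> [i v|v i|v i j|v w] /=.
- by rewrite /recoloring qE sw_edge (frameK ln).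
- exact: (frame_adj ln).
- by move=> /(frame_inj ln)/(can_inj (swK _)).
- by move=> /(frame_surj ln)[i ->]; exists (sw (q v) i); rewrite /recoloring swK.
Qed.

(** The automorphisms g with q o g = q preserve the old colouring if and only if they
preserve the new one, because each colouring is computed from the other and q. *)
Lemma recoloring_aut : subgroupI (coloring_aut T recoloring) (fiber_stab T q)
  = subgroupI (coloring_aut T n) (fiber_stab T q).
Proof.
apply: subgroup_ext => g; split=> -[gn gq]; split=> // i v.
  by have := gn (sw (q v) i) v; rewrite /recoloring gq swK.
by rewrite /recoloring gn gq.
Qed.

End Recoloring.

Lemma conj_coloring_aut (V : choiceType) (T : rel V) (d : nat) (n n' : 'I_d -> V -> V)
    (g : graph_aut T) :
  (forall i v, g (n i v) = n' i (g v)) ->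
  conj_subgroup g (coloring_aut T n) = coloring_aut T n'.
Proof.
move=> gn; apply: subgroup_ext => h; have [gK Kg _] := inv_funP g.
split=> [[k kn <-] i v|hn].
  by rewrite /= -{1}[v]Kg -gn gK kn gn.
exists (g^-1 * h * g); last by rewrite !mulgA mulgV mul1g mulgK.
by move=> i v /=; rewrite gn hn -{1}[h (g v)]Kg -gn gK.
Qed.

Lemma prime_ndvd_fact p k : prime p -> (k < p)%N -> ~~ (p %| k`!)%N.
Proof.
move=> p_pr; elim: k => [|k IH] kp; first by rewrite fact0 dvdn1; case: eqP p_pr => // ->.
by rewrite factS Euclid_dvdM // gtnNdvd //=; apply: IH; exact: ltnW.
Qed.

(** The groups of the two colourings are conjugate by g and share the subgroup D that
fixes q. Their indices over D are computed by the two monodromy groups on Y, in which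
point stabilisers have order dividing (|Y| - 1)! and contribute 0. *)
Lemma recoloring_witness (V : choiceType) (T : rel V) (d : nat) (n : 'I_d -> V -> V)
    (Y : finType) (a b : 'I_d -> {perm Y}) (sw : Y -> 'I_d -> 'I_d) (y0 : Y) :
  is_tree T -> legal_coloring T n ->
  (forall i, a i * a i = 1) -> (forall i, b i * b i = 1) ->
  (forall y, involutive (sw y)) -> (forall y i, sw (a (sw y i) y) i = sw y i) ->
  (forall i y, b i y = a (sw y i) y) ->
  exists2 g, carrier (commensurator (coloring_aut T n)) g &
    forall p, prime p -> (#|Y| <= p)%N ->
      comm_hom p (coloring_aut T n) g =
      ((subnormal_count p <<[set a i | i in 'I_d]>>%G)%:Z
       - (subnormal_count p <<[set b i | i in 'I_d]>>%G)%:Z)%R.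
Proof.
move=> T_tree ln aK bK swK sw_edge bE; have [v0 _] := tree_inhabited T_tree.
have aKf i : involutive (a i) by move=> y; rewrite -permM aK perm1.
have [q [q0 qE]] := equivariant_map T_tree ln aKf v0 y0.
pose n' := recoloring n q sw.
have ln' : legal_coloring T n'.
  exact: (recoloring_legal (a := fun i => a i) ln qE swK sw_edge).
have q'E i v : q (n' i v) = b i (q v) by rewrite bE /n' /recoloring qE.
have [g [_ gn]] := coloring_transport T_tree ln ln' v0 v0.
have gE := conj_coloring_aut gn.
pose D := subgroupI (coloring_aut T n) (fiber_stab T q).
have DE : subgroupI (coloring_aut T n') (fiber_stab T q) = D by exact: recoloring_aut.
have sep := monodromy_separates T_tree v0 ln aK qE.
have := monodromy_separates T_tree v0 ln' bK q'E; rewrite DE => sep'.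
have [f f'] := (separates_few_cosets sep, separates_few_cosets sep').
have sD : sub_subgroup D (coloring_aut T n) by move=> x [].
have sD' : sub_subgroup D (coloring_aut T n') by rewrite -DE => x [].
have sup (A B C : subgroup (graph_aut T)) :
    sub_subgroup B C -> few_cosets A B -> few_cosets A C.
  by move=> sBC [S fS hS]; exists S => // x /hS[s Ss /sBC]; exists s.
exists g; first by rewrite /= gE; apply/commensurableP; split; [exact: sup f|exact: sup f'].
move=> p p_pr leYp; rewrite /comm_hom gE (rel_indexE p_pr sD sD' f f').
rewrite (gen_indexE p_pr sD sep) (gen_indexE p_pr sD' sep') /quotient_index.
have Y_gt0 : (0 < #|Y|)%N by apply/card_gt0P; exists y0.
have count0 (H : {group {perm Y}}) :
    H \subset perm.Sym [set~ q v0] -> subnormal_count p H = 0.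
  move=> sH; apply: subnormal_count_p'group => //; apply/negP => pH.
  have := dvdn_trans pH (cardSg sH); rewrite perm.card_Sym cardsC1.
  by apply/negP/prime_ndvd_fact; rewrite ?prednK.
have im0 := image_fiber_stab T_tree v0 ln aK qE.
have := image_fiber_stab T_tree v0 ln' bK q'E; rewrite DE => im0'.
rewrite (count0 _ im0) (count0 _ im0') !GRing.subr0.
by rewrite (image_monodromy T_tree v0 ln aK) (image_monodromy T_tree v0 ln' bK).
Qed.

(** * A dihedral and a symmetric colouring of the same graph on Z/p *)

Section DihedralSymmetric.
Variables (m d : nat).
Let p := m.+2.
Hypothesis p_pr : prime p.
Hypothesis p_gt4 : (4 < p)%N.
Local Notation Y := 'I_m.+2.

Lemma mirror_perm_inj : injective (fun x : Y => (1 - x)%R).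
Proof. by move=> x y /GRing.addrI/GRing.oppr_inj. Qed.

Definition neg_perm : {perm Y} := perm (@GRing.oppr_inj Y).
Definition mirror_perm : {perm Y} := perm mirror_perm_inj.
Definition shift_perm : {perm Y} := perm (@GRing.addrI Y 1%R).
Definition swap01_perm : {perm Y} := tperm 0%R 1%R.

Lemma neg_permK : neg_perm * neg_perm = 1.
Proof. by apply/permP => x; rewrite permM !permE GRing.opprK. Qed.
Lemma mirror_permK : mirror_perm * mirror_perm = 1.
Proof. by apply/permP => x; rewrite permM !permE GRing.subKr. Qed.
Lemma neg_mirror : neg_perm * mirror_perm = shift_perm.
Proof. by apply/permP => x; rewrite permM !permE GRing.opprK. Qed.

Lemma mirror01 x :
  (mirror_perm x == 0%R) || (mirror_perm x == 1%R) = (x == 0%R) || (x == 1%R).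
Proof.
rewrite permE orbC GRing.subr_eq0 -{2}[1%R]GRing.subr0 (inj_eq (@GRing.addrI _ _)).
by rewrite (inj_eq (@GRing.oppr_inj _)) [1%R == x]eq_sym.
Qed.

Lemma swap01_permE x :
  swap01_perm x = if (x == 0%R) || (x == 1%R) then mirror_perm x else x.
Proof.
rewrite permE /= permE.
have [->|x0] := eqVneq x 0%R; first by rewrite GRing.subr0.
by have [->|x1] := eqVneq x 1%R; rewrite ?GRing.subrr.
Qed.

Lemma mirror_perm_swapC : mirror_perm * swap01_perm = swap01_perm * mirror_perm.
Proof.
apply/permP => x; rewrite !permM !swap01_permE mirror01.
by case: ifP => // _; rewrite -!permM mirror_permK.
Qed.

(** The two nontrivial involutions are reflections of a regular p-gon. *)
Definition dih_perm (i : 'I_d) : {perm Y} :=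
  match val i with 0 => neg_perm | 1 => mirror_perm | _ => 1 end.

(** The reflection [mirror_perm] is split into the transposition of 0 and 1, which keeps
the colour 1, and the product of its other transpositions, which receives colour 2. *)
Definition sym_perm (i : 'I_d) : {perm Y} :=
  match val i with
  | 0 => neg_perm
  | 1 => swap01_perm
  | 2 => mirror_perm * swap01_perm
  | _ => 1
  end.

Lemma dih_permK i : dih_perm i * dih_perm i = 1.
Proof.
by rewrite /dih_perm; case: (val i) => [|[|k]]; rewrite ?neg_permK ?mirror_permK ?mulg1.
Qed.

Lemma sym_permK i : sym_perm i * sym_perm i = 1.
Proof.
rewrite /sym_perm; case: (val i) => [|[|[|k]]]; rewrite ?neg_permK ?tperm2 ?mulg1 //.
by rewrite {2}mirror_perm_swapC mulgA -[mirror_perm * _ * _]mulgA tperm2 mulg1 mirror_permK.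
Qed.

Hypothesis d_ge3 : (3 <= d)%N.
Let i1 : 'I_d := Ordinal (leq_trans (isT : 1 < 3)%N d_ge3).
Let i2 : 'I_d := Ordinal (leq_trans (isT : 2 < 3)%N d_ge3).
Let i0 : 'I_d := Ordinal (leq_trans (isT : 0 < 3)%N d_ge3).

Definition recolor (y : Y) (i : 'I_d) : 'I_d :=
  if (y == 0%R) || (y == 1%R) then i else tperm i1 i2 i.

Lemma recolorK y : involutive (recolor y).
Proof. by move=> i; rewrite /recolor; case: (_ || _) => //; rewrite tpermK. Qed.

Lemma color_cases (i : 'I_d) : [\/ i = i0, i = i1, i = i2 |
   [/\ (2 < i)%N, tperm i1 i2 i = i, dih_perm i = 1 & sym_perm i = 1]].
Proof.
case: i => [[|[|[|k]]] hi].
- by constructor 1; apply: val_inj.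
- by constructor 2; apply: val_inj.
- by constructor 3; apply: val_inj.
by constructor 4; split=> //; rewrite tpermD.
Qed.

Lemma recolor_edge y i : recolor (dih_perm (recolor y i) y) i = recolor y i.
Proof.
have t0 : tperm i1 i2 i0 = i0 by rewrite tpermD.
rewrite /recolor.
have [->|->|->|[_ ti di _]] := color_cases i;
  have [y01|/negbTE y01] := boolP ((y == 0%R) || (y == 1%R)).
all: rewrite ?y01 ?t0 ?tpermL ?tpermR ?ti ?if_same //.
- by rewrite /dih_perm /= mirror01 y01.
- by rewrite /dih_perm /= perm1 y01.
- by rewrite /dih_perm /= perm1 y01.
- by rewrite /dih_perm /= mirror01 y01.
Qed.

Lemma sym_dih i y : sym_perm i y = dih_perm (recolor y i) y.
Proof.
have t0 : tperm i1 i2 i0 = i0 by rewrite tpermD.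
rewrite /recolor.
have [->|->|->|[_ ti di si]] := color_cases i;
  have [y01|/negbTE y01] := boolP ((y == 0%R) || (y == 1%R)).
all: rewrite ?y01 ?t0 ?tpermL ?tpermR ?ti ?di ?si // /sym_perm /dih_perm /=.
all: rewrite ?permM ?perm1 ?swap01_permE ?mirror01 ?y01 //.
by rewrite -permM mirror_permK perm1.
Qed.

Lemma order_shift : #[shift_perm] = p.
Proof.
have itE j k : (shift_perm ^+ j) k = (1 *+ j + k)%R.
  elim: j => [|j IH]; first by rewrite perm1 GRing.mulr0n GRing.add0r.
  by rewrite expgSr permM IH permE GRing.mulrS GRing.addrA.
have dv : (#[shift_perm] %| p)%N.
  rewrite order_dvdn; apply/eqP/permP => k; rewrite itE perm1.
  by rewrite Zp_mulrn (_ : inZp _ = 0%R) ?GRing.add0r //; apply: val_inj; rewrite /= modnMl.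
move: p_pr => /primeP[_ /(_ _ dv)] /orP[|/eqP//].
by rewrite order_eq1 => /eqP/permP/(_ 0%R); rewrite permE perm1.
Qed.

Lemma dvdn_perm_fact (H : {group {perm Y}}) : (#|H| %| p`!)%N.
Proof. by have := cardSg (subsetT H); rewrite /= card_Sym card_ord. Qed.

Lemma logn_perm_group (H : {group {perm Y}}) : shift_perm \in H -> logn p #|H| = 1%N.
Proof.
move=> sH; apply/eqP; rewrite eqn_leq; apply/andP; split.
  apply: leq_trans (dvdn_leq_log _ (fact_gt0 _) (dvdn_perm_fact H)) _.
  rewrite factS lognM ?fact_gt0 // logn_prime // eqxx.
  by rewrite lognE p_pr fact_gt0 /= (negPf (prime_ndvd_fact p_pr (ltnSn _))).
by rewrite -(pfactor_dvdn 1) // expn1 -order_shift; apply: order_dvdG.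
Qed.

(** The rotations form a normal subgroup of order p, and p divides p! only once. *)
Lemma count_dih : subnormal_count p <<[set dih_perm i | i in 'I_d]>>%G = 1%N.
Proof.
set H := <<_>>%G; have h i : dih_perm i \in H by exact/mem_gen/imset_f.
have h0 : neg_perm \in H := h i0.
have h1 : mirror_perm \in H := h i1.
have sH : shift_perm \in H by rewrite -neg_mirror groupM.
apply: (@subnormal_count_normal_prime _ p_pr _ _ <[shift_perm]>%G).
- rewrite /normal cycle_subG sH gen_subG /=; apply/subsetP => _ /imsetP[i _ ->].
  have nN s : shift_perm ^ s = shift_perm^-1 -> s \in 'N(<[shift_perm]>).
    by move=> ss; rewrite inE -cycleJ cycle_subG ss groupV cycle_id.
  have negV : neg_perm^-1 = neg_perm by apply/(mulgI neg_perm); rewrite mulgV neg_permK.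
  have mirV : mirror_perm^-1 = mirror_perm.
    by apply/(mulgI mirror_perm); rewrite mulgV mirror_permK.
  rewrite /dih_perm; case: (val i) => [|[|k]]; last exact: group1.
    by apply: nN; rewrite -neg_mirror invMg negV mirV conjgE negV !mulgA neg_permK mul1g.
  by apply: nN; rewrite -neg_mirror invMg negV mirV conjgE mirV -!mulgA mirror_permK mulg1.
- exact: order_shift.
- exact: logn_perm_group.
Qed.

(** A transposition and a p-cycle generate the symmetric group of prime degree p. *)
Lemma count_sym : subnormal_count p <<[set sym_perm i | i in 'I_d]>>%G = 0.
Proof.
set H := <<_>>%G; have h i : sym_perm i \in H by exact/mem_gen/imset_f.
have h0 : neg_perm \in H := h i0.
have h1 : swap01_perm \in H := h i1.
have h2 : mirror_perm * swap01_perm \in H := h i2.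
have sH : shift_perm \in H.
  by rewrite -neg_mirror groupM // -[mirror_perm]mulg1 -(tperm2 0%R 1%R) mulgA groupM.
rewrite (_ : H = [set: {perm Y}]%G); first by apply: subnormal_count_Sym; rewrite ?card_ord.
apply/group_inj/eqP; rewrite eqEsubset subsetT /=.
have <- : <<[set swap01_perm; shift_perm]>> = [set: {perm Y}].
  by apply: gen_tperm_circular_shift; rewrite ?card_ord ?order_shift.
by rewrite gen_subG; apply/subsetP => s /[!inE] /orP[] /eqP ->.
Qed.

Lemma count_large q (H : {group {perm Y}}) :
  prime q -> (p < q)%N -> subnormal_count q H = 0.
Proof.
move=> q_pr ltpq; apply: subnormal_count_p'group => //; apply/negP => qH.
by have := dvdn_trans qH (dvdn_perm_fact H); apply/negP/prime_ndvd_fact.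
Qed.

End DihedralSymmetric.

From mathcomp Require Import all_classical topology freeg.
Import Defs.
Local Open Scope classical_set_scope.
Local Open Scope quotient_scope.
Local Open Scope group_scope.

(** * Equivariant matchings *)

(** The pigeonhole principle for subsets of a type that need not be finite. *)
Lemma finite_inj_surj (X : choiceType) (A : set X) (f : X -> X) :
  finite_set A -> (forall x, A x -> A (f x)) -> {in A &, injective f} ->
  forall y, A y -> exists2 x, A x & f x = y.
Proof.
move=> /finite_seqP[s0 sE] fA finj y Ay.
pose s := undup s0; have sA x : (x \in s) = (x \in A).
  by rewrite sE mem_undup; apply/idP/idP; rewrite inE.
have us : uniq (map f s).
  by rewrite map_inj_in_uniq ?undup_uniq // => a b; rewrite !sA; exact: finj.
have [|_ e] := uniq_min_size us _ (eq_leq (esym (size_map f s))).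
  by move=> _ /mapP[x + ->]; rewrite !sA !inE; exact: fA.
have : y \in map f s by rewrite e sA inE.
by move=> /mapP[x + ->]; rewrite sA inE => Ax; exists x.
Qed.

(** X is a set over the oriented edges (pi x, e x) of the graph, on which the whole
automorphism group acts, with finite fibres; H acts freely and moves no
vertex to a neighbour. The fibres over an edge and over its reverse have the same size,
because an automorphism flips the edge. The aim is an H-equivariant involution
of X that covers the reversal of edges. *)
Section Matching.
Variables (V : choiceType) (T : rel V) (X : choiceType).
Variables (ax : graph_aut T -> X -> X) (pi e : X -> V) (H : subgroup (graph_aut T)).
Hypothesis axM : forall g h x, ax (g * h) x = ax g (ax h x).
Hypothesis ax1 : forall x, ax 1 x = x.
Hypothesis piE : forall g x, pi (ax g x) = g (pi x).
Hypothesis eE : forall g x, e (ax g x) = g (e x).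
Hypothesis adj_e : forall x, T (pi x) (e x).
Hypothesis flip : forall v w, T v w -> exists g : graph_aut T, g v = w /\ g w = v.
Hypothesis fin : forall v, finite_set [set x | pi x = v].
Hypothesis free : forall g x, carrier H g -> ax g x = x -> g = 1.
Hypothesis noinv : forall g v, carrier H g -> ~ T v (g v).

Let axV g x y : ax g x = y -> x = ax g^-1 y.
Proof. by move=> <-; rewrite -axM mulVg ax1. Qed.

Definition partial_matching (R : set (X * X)) :=
  [/\ forall x y, R (x, y) -> R (y, x),
      forall x y z, R (x, y) -> R (x, z) -> y = z,
      forall g x y, carrier H g -> R (x, y) -> R (ax g x, ax g y) &
      forall x y, R (x, y) -> pi y = e x].

(** Otherwise some x is unmatched. Were all points over the reversed edge matched, they would
match injectively into the fibre of x and miss x, against the equality of the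
sizes of the fibres. So some y over the reversed edge is unmatched too, and the
H-orbit of the pair (x, y) can be added to R: freeness makes it a function, and the
absence of inversions makes the orbits of x and y disjoint. *)
Lemma partial_matching_total R : partial_matching R ->
  (forall S, R `<` S -> ~ partial_matching S) -> forall x, exists y, R (x, y).
Proof.
move=> [Rs Rf RH Rpi] Rmax x; apply: contrapT => nx.
pose F v w := [set z | pi z = v /\ e z = w].
have [s [sx se]] := flip (adj_e x).
have [y [[py ey] ny]] : exists y, F (e x) (pi x) y /\ ~ exists z, R (y, z).
  apply: contrapT => no.
  have part z : exists z', F (e x) (pi x) z -> R (z, z').
    case: (pselect (F (e x) (pi x) z)) => Fz; last by exists z.
    apply: contrapT => nz; apply: no; exists z; split=> // -[z' zz']; apply: nz.
    by exists z'.
  pose f z := projT1 (cid (part z)).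
  have fE z : F (e x) (pi x) z -> R (z, f z) by rewrite /f; case: cid.
  have sF z : F (pi x) (e x) z -> F (e x) (pi x) (ax s z).
    by move=> [pz ez]; split; rewrite ?piE ?eE ?pz ?ez.
  (* Flip the edge of z to its reverse, then take the partner. *)
  have [||||z Fz zx] := @finite_inj_surj X (F (pi x) (e x)) (f \o ax s) _ _ _ x.
  - by apply: sub_finite_set (fin (pi x)) => z [].
  - move=> z Fz; have /fE h := sF _ Fz; split; rewrite /= ?(Rpi _ _ h).
      by have [_ ->] := sF _ Fz.
    by rewrite -(Rpi _ _ (Rs _ _ h)); have [-> _] := sF _ Fz.
  - move=> z z' /set_mem Fz /set_mem Fz' /= ff.
    have /fE/Rs h := sF _ Fz; have /fE/Rs h' := sF _ Fz'.
    rewrite -ff in h'; have /(congr1 (ax s^-1)) := Rf _ _ _ h h'.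
    by rewrite -!axM mulVg !ax1.
  - by [].
  - have /fE/Rs := sF _ Fz; rewrite -[f _]/((f \o ax s) z) zx => h.
    by apply: nx; exists (ax s z).
pose N := [set u : X * X | exists2 g, carrier H g &
  u = (ax g x, ax g y) \/ u = (ax g y, ax g x)].
have NR u v w : N (u, v) -> ~ R (u, w).
  move=> [g Hg [[-> _]|[-> _]]] /(RH _ _ _ (subgroupV Hg));
    rewrite -!axM mulVg ax1 => h'.
    by apply: nx; eexists; exact: h'.
  by apply: ny; eexists; exact: h'.
have xy_disj g h : carrier H g -> carrier H h -> ax g x <> ax h y.
  move=> Hg Hh /(congr1 (ax h^-1)); rewrite -!axM mulVg ax1 => /(congr1 pi).
  rewrite piE py => E; apply: (noinv (subgroupM (subgroupV Hh) Hg) (v := pi x)).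
  by rewrite E adj_e.
have ax_inj g h z : carrier H g -> carrier H h -> ax g z = ax h z -> g = h.
  move=> Hg Hh /(congr1 (ax h^-1)); rewrite -!axM mulVg ax1 => /free h1.
  by have := h1 (subgroupM (subgroupV Hh) Hg) => /(congr1 (mulg h)); rewrite mulg1 mulKVg.
apply: (Rmax (R `|` N)).
  split; first by move=> u Ru; left.
  move=> /(_ (x, y)) h; apply: nx; exists y; apply: h; right.
  by exists 1; [exact: subgroup1|left; rewrite !ax1].
split.
- move=> u v [/Rs|[g Hg [[-> ->]|[-> ->]]]]; first by left.
    by right; exists g => //; right.
  by right; exists g => //; left.
- move=> u v w [Ruv|Nuv] [Ruw|Nuw].
  + exact: Rf Ruv Ruw.
  + by case: (NR _ _ _ Nuw Ruv).
  + by case: (NR _ _ _ Nuv Ruw).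
  move: Nuv Nuw => [g Hg [[-> ->]|[-> ->]]] [h Hh [[gh ->]|[gh ->]]].
  + by rewrite (ax_inj _ _ _ Hg Hh gh).
  + by case: (xy_disj _ _ Hg Hh gh).
  + by case: (xy_disj _ _ Hh Hg (esym gh)).
  + by rewrite (ax_inj _ _ _ Hg Hh gh).
- move=> g u v Hg [/(RH _ _ _ Hg)|[h Hh [[-> ->]|[-> ->]]]]; first by left.
    by right; exists (g * h); [exact: subgroupM|left; rewrite !axM].
  by right; exists (g * h); [exact: subgroupM|right; rewrite !axM].
- move=> u v [/Rpi//|[g _ [[-> ->]|[-> ->]]]].
    by rewrite piE eE py.
  by rewrite piE eE ey.
Qed.

Lemma equivariant_matching : exists M : X -> X, [/\ involutive M,
  forall g x, carrier H g -> M (ax g x) = ax g (M x) & forall x, pi (M x) = e x].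
Proof.
have [F FP totF|R [Rm Rmax]] := @Zorn_bigcup _ partial_matching.
  split.
  - by move=> x y [S FS Sxy]; exists S => //; have [h _ _ _] := FP _ FS; exact: h.
  - move=> x y z [S FS Sxy] [S' FS' Sxz].
    have [_ Sf _ _] := FP _ FS; have [_ Sf' _ _] := FP _ FS'.
    have [/(_ _ Sxy) h|/(_ _ Sxz) h] := totF _ _ FS FS'; [exact: Sf' h Sxz|exact: Sf Sxy h].
  - by move=> g x y Hg [S FS Sxy]; exists S => //; have [_ _ h _] := FP _ FS; exact: h.
  - by move=> x y [S FS Sxy]; have [_ _ _ h] := FP _ FS; exact: h.
have tot := partial_matching_total Rm Rmax; case: Rm => Rs Rf RH Rpi.
pose M x := projT1 (cid (tot x)); have ME x : R (x, M x) by rewrite /M; case: cid.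
exists M; split=> [x|g x Hg|x]; last exact: Rpi.
- exact: Rf (ME _) (Rs _ _ (ME _)).
- exact: Rf (ME _) (RH _ _ _ Hg (ME _)).
Qed.

End Matching.

(** * Discreteness and cocompactness in terms of vertices *)

Section Lattice.
Variables (V : choiceType) (T : rel V).

(** Evaluation at a vertex is continuous for the topology of pointwise convergence. *)
Lemma open_eval (v w : V) : open [set g : graph_aut T | g v = w].
Proof.
exists [set f : {ptws V -> discrete_topology V} | f v = w]; last by [].
rewrite openE => f /= fv; rewrite /interior.
have /cvg_sup/(_ v) h : nbhs (f : {ptws V -> discrete_topology V})
  --> (f : {ptws V -> discrete_topology V}) by [].
apply: h => /=; exists [set g : V -> V | g v = w]; split=> //.
by exists [set w]; [exact: discrete_open|].
Qed.

(** The pointwise stabilisers of finite sets of vertices form a basis of neighbourhoods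
of 1, and 1 is isolated in H. *)
Lemma discrete_subgroup_finite_support (H : subgroup (graph_aut T)) :
  discrete_subgroup H -> exists s : seq V,
    forall g, carrier H g -> (forall v, v \in s -> g v = v) -> g = 1.
Proof.
move=> /(_ [set 1])[U [B oB BU] U1].
pose fixing (s : seq V) := [set f : V -> V | forall v, v \in s -> f v = v].
pose F := filter_from [set: seq V] fixing.
have FF : Filter F.
  apply: filter_from_filter; first by exists [::].
  move=> s t _ _; exists (s ++ t) => // f sf.
  by split=> v vs; apply: sf; rewrite mem_cat vs ?orbT.
(* The sets of maps that fix a given finite set of vertices generate the
   neighbourhoods of the identity. *)
have Fid : F --> (id : {ptws V -> discrete_topology V}).
  apply/cvg_sup => v A [_ [[O oO <-] Ov] OA].
  exists [:: v] => // f fv; apply: OA => /=; rewrite fv ?mem_head //.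
have B1 : B id.
  have : U 1 by have : [set 1 : set_type H] 1 by []; rewrite -U1.
  by rewrite -BU.
have [s _ sB] : F B by apply: Fid; exact: open_nbhs_nbhs.
exists s => g Hg gs; pose h : set_type H := exist _ g (mem_set Hg).
have : [set 1] h.
  rewrite -U1 /= -BU; exact: sB.
by move=> /(congr1 val).
Qed.

(** The quotient G/H is covered by the open sets of the classes gH some element of
which maps w to v0; finitely many vertices w suffice by compactness, and transitivity of G
turns this into finitely many orbits of H. *)
Lemma cocompact_finite_orbits (H : subgroup (graph_aut T)) (v0 : V) :
  (forall v, exists g : graph_aut T, g v = v0) ->
  cocompact_subgroup H -> exists s : seq V,
    forall v, exists2 g, carrier H g & g v \in s.
Proof.
move=> trans cptH; pose Q := quotient_topology (coset_space H).
pose W (w : V) : set Q := [set c | exists g : graph_aut T, \pi_Q g = c /\ g w = v0].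
have oW w : open (W w).
  rewrite /open /= /quotient_open.
  rewrite (_ : _ @^-1` _ = \bigcup_(k in carrier H) [set g : graph_aut T | g (k w) = v0]).
    by apply: bigcup_open => k _; exact: open_eval.
  apply/seteqP; split=> g /=.
    move=> [h [/coset_eqP hg hw]]; exists (g^-1 * h).
      by have := subgroupV hg; rewrite invgM invgK.
    by rewrite /= -hw; have [_ Kg _] := inv_funP g; rewrite Kg.
  move=> [k Hk /= gk]; exists (g * k); split=> //.
  by apply/coset_eqP; rewrite invgM mulgVK; exact: subgroupV.
have covW c : exists w, W w c.
  rewrite -[c]reprK; move: (generic_quotient.repr c) => g; have [_ Kg _] := inv_funP g.
  by exists (inv_fun g v0), g; split; [|exact: Kg].
have [s sW] : exists s : seq V, forall c, exists2 w, w \in s & W w c.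
  apply: contrapT => nos.
  pose F := filter_from [set: seq V] (fun s => [set c | forall w, w \in s -> ~ W w c]).
  have FF : ProperFilter F.
    apply: filter_from_proper.
      apply: filter_from_filter; first by exists [::].
      move=> s t _ _; exists (s ++ t) => // c sc.
      by split=> w ws; apply: sc; rewrite mem_cat ws ?orbT.
    move=> s _; apply: contrapT => s0; apply: nos; exists s => c.
    apply: contrapT => nc; apply: s0; exists c => w ws Wc; apply: nc.
    by exists w.
  have [c [_ cF]] := cptH F FF filterT.
  have [w Wc] := covW c.
  have [||c' [h Wc']] := cF [set c | forall w', w' \in [:: w] -> ~ W w' c] (W w).
  - by exists [:: w].
  - exact: open_nbhs_nbhs.
  - by apply: h Wc'; exact: mem_head.
exists s => v; have [g gv] := trans v.
have [w ws [h [/coset_eqP hg hw]]] := sW (\pi_Q g).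
exists (h^-1 * g) => //; have [hK _ _] := inv_funP h.
by rewrite /= gv -hw hK.
Qed.

End Lattice.

(** * Cocompact lattices are commensurable to automorphism groups of colourings *)

Section Balls.
Variables (V : choiceType) (T : rel V) (d : nat) (n : 'I_d -> V -> V).
Hypothesis T_tree : is_tree T.
Hypothesis ln : legal_coloring T n.

Fixpoint word_ball r v : seq V :=
  if r is r'.+1 then v :: flatten [seq word_ball r' (n i v) | i <- enum 'I_d] else [:: v].

Lemma word_ballP r v x :
  reflect (exists2 w, (size w <= r)%N & walk n v w = x) (x \in word_ball r v).
Proof.
apply: (iffP idP).
  elim: r v => [|r IH] v /=; first by rewrite inE => /eqP->; exists [::].
  rewrite inE => /orP[/eqP->|/flatten_mapP[i _ /IH[w sw <-]]]; first by exists [::].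
  by exists (i :: w).
move=> [w sw <-]; elim: r v w sw => [|r IH] v [|i w] //= sw; rewrite ?mem_head //.
rewrite inE; apply/orP; right; apply/flatten_mapP.
by exists i; rewrite ?mem_enum //; exact: IH.
Qed.

(** Automorphisms do not preserve colours, but they map walks to walks of the same
length. *)
Lemma word_ball_aut (g : graph_aut T) r v x :
  x \in word_ball r v -> g x \in word_ball r (g v).
Proof.
move=> /word_ballP[w sw <-].
suff [w' e <-] : exists2 w', size w' = size w & walk n (g v) w' = g (walk n v w).
  by apply/word_ballP; exists w'; rewrite ?e.
elim: w v {sw} => [|i w IH] v; first by exists [::].
have : T (g v) (g (n i v)) by have [_ ->] := autP g; exact: (frame_adj ln).
move=> /(frame_surj ln)[j e]; have [w' sw' hw'] := IH (n i v).
by exists (j :: w'); rewrite /= ?sw' // -[n j _]e.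
Qed.

Lemma word_ball_cover (us s : seq V) :
  exists r, forall u x, u \in us -> x \in s -> x \in word_ball r u.
Proof.
pose w u x := projT1 (cid (walk_connected T_tree ln u x)).
exists (\max_(u <- us) \max_(x <- s) size (w u x)) => u x uus xs.
apply/word_ballP; exists (w u x); last by rewrite /w; case: cid.
apply: leq_trans (leq_bigmax_seq (F := fun u => \max_(x <- s) size (w u x)) u uus isT).
exact: (leq_bigmax_seq (F := fun x => size (w u x)) x xs isT).
Qed.

End Balls.

Lemma finite_seqs (V : choiceType) (t : seq V) k :
  finite_set [set s : seq V | size s = k /\ {subset s <= t}].
Proof.
elim: k => [|k IH].
  apply: (@sub_finite_set _ _ [set [::]]); last exact: finite_set1.
  by move=> s [/size0nil -> _].
apply: (@sub_finite_set _ _ [set x :: s | x in [set` t] &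
    s in [set s : seq V | size s = k /\ {subset s <= t}]]).
  move=> [|x s] [//= [sk] st]; exists x; first by apply: st; exact: mem_head.
  by exists s => //; split=> // y ys; apply: st; rewrite inE ys orbT.
by apply: finite_image2 => //; exact: finite_finpred.
Qed.

Section LatticeColoring.
Variables (V : choiceType) (T : rel V) (d : nat).
Hypothesis T_tree : is_tree T.
Variable n0 : 'I_d -> V -> V.
Hypothesis ln0 : legal_coloring T n0.

Lemma parity_exists : exists par : V -> bool, forall v w, T v w -> par w = ~~ par v.
Proof.
have [v0 _] := tree_inhabited T_tree.
have [par [_ parE]] := equivariant_map T_tree ln0 (fun=> negbK) v0 true.
by exists par => v w /(frame_surj ln0)[i ->]; rewrite parE.
Qed.

Lemma parity_aut (par : V -> bool) : (forall v w, T v w -> par w = ~~ par v) ->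
  forall (g : graph_aut T) v w, par (g v) (+) par v = par (g w) (+) par w.
Proof.
move=> parT g v w; have [u <-] := walk_connected T_tree ln0 v w.
elim/last_ind: u => [|u i ->] //; rewrite -cats1 walk_cat /=.
set x := walk n0 v u; have Tx : T x (n0 i x) by exact: (frame_adj ln0).
have Tgx : T (g x) (g (n0 i x)) by have [_ ->] := autP g.
by rewrite (parT _ _ Tx) (parT _ _ Tgx) addNb addbN negbK.
Qed.

(** An automorphism either preserves the bipartition of the tree or exchanges its two
classes. *)
Lemma few_cosets_parity (par : V -> bool) (H : subgroup (graph_aut T)) :
  (forall v w, T v w -> par w = ~~ par v) ->
  few_cosets H (subgroupI H (fiber_stab T par)).
Proof.
move=> parT; have [v0 _] := tree_inhabited T_tree.
apply: (few_cosets_fun (h := fun g : graph_aut T => par (g v0) (+) par v0)).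
  exact: finite_finset.
move=> g h Hg Hh gh; split; first exact: subgroupM (subgroupV Hg) Hh.
move=> v /=; have [gK Kg _] := inv_funP g.
have := parity_aut parT h v v0; rewrite -gh (parity_aut parT g v0 (inv_fun g (h v))) Kg.
by move=> /addbI.
Qed.

End LatticeColoring.

(** The group K permutes the orbits of the moves, and such an orbit is determined by
its point over v0; the fibre over v0 being finite, the stabiliser in K of the
orbit of x0 has finite index. It preserves the colouring read along that orbit. *)
Lemma frame_coloring_few_cosets (V : choiceType) (T : rel V) (d : nat) (X : Type)
    (ax : graph_aut T -> X -> X) (pi : X -> V) (M : 'I_d -> X -> X)
    (K : subgroup (graph_aut T)) (x0 : X) :
  is_tree T -> frame_system T pi M ->
  (forall g h x, ax (g * h) x = ax g (ax h x)) -> (forall x, ax 1 x = x) ->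
  (forall g x, pi (ax g x) = g (pi x)) ->
  (forall i g x, carrier K g -> M i (ax g x) = ax g (M i x)) ->
  (forall v, finite_set [set x | pi x = v]) ->
  exists2 n : 'I_d -> V -> V, legal_coloring T n & few_cosets K (coloring_aut T n).
Proof.
move=> T_tree fsM axM ax1 piE MK fin; have [s [pis _ sM ls]] := frame_section T_tree fsM x0.
set n := (n in legal_coloring T n) in ls; exists n => //.
have nE i v : s (n i v) = M i (s v) by exact: sM.
have s_walk v w : s (walk n v w) = walk M (s v) w.
  by elim/last_ind: w => [|w i IH] //; rewrite -cats1 !walk_cat /= nE IH.
have ax_walk g x w : carrier K g -> ax g (walk M x w) = walk M (ax g x) w.
  by move=> Kg; elim/last_ind: w => [|w i IH] //; rewrite -cats1 !walk_cat /= -IH MK.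
have ax_s g a b : carrier K g -> ax g (s a) = s b -> carrier (coloring_aut T n) g.
  move=> Kg gab.
  have gs u : ax g (s u) = s (g u).
    have [w <-] := walk_connected T_tree ls a u.
    have e : ax g (s (walk n a w)) = s (walk n b w) by rewrite !s_walk ax_walk // gab.
    by rewrite e; congr s; have := congr1 pi e; rewrite piE !pis.
  by move=> i v; have := congr1 pi (gs (n i v)); rewrite pis -piE nE -MK // gs.
have [v0 _] := tree_inhabited T_tree.
apply: (few_cosets_fun (h := fun g => ax g (s (g^-1 v0)))).
  apply: sub_finite_set (fin v0) => _ [g _ <-] /=; rewrite piE pis.
  by have [_ Kg _] := inv_funP g; exact: Kg.
move=> g h Kg Kh /(congr1 (ax g^-1)); rewrite -!axM mulVg => e.
apply: (ax_s _ (h^-1 v0) (g^-1 v0)); first exact: subgroupM (subgroupV Kg) Kh.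
by rewrite -e ax1.
Qed.

Section LatticeMain.
Variables (V : choiceType) (T : rel V) (d : nat).
Hypothesis T_tree : is_tree T.
Variable n0 : 'I_d -> V -> V.
Hypothesis ln0 : legal_coloring T n0.

(** The automorphisms of a colouring are determined by the image of v0, and a subgroup of
H of finite index that preserves the colouring has finitely many orbits of
vertices. *)
Lemma few_cosets_coloring_aut (n : 'I_d -> V -> V) (H : subgroup (graph_aut T))
    (us : seq V) :
  legal_coloring T n -> few_cosets H (coloring_aut T n) ->
  (forall v, exists2 g, carrier H g & g v \in us) ->
  few_cosets (coloring_aut T n) H.
Proof.
move=> ln fH orb; have [v0 _] := tree_inhabited T_tree.
pose K := subgroupI H (coloring_aut T n).
have [S fS cS] : few_cosets H K by exact: few_cosetsI.
have orbK v : exists u, [set s^-1 u | s in S & u in [set` us]] u /\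
    exists2 g, carrier K g & v = g u.
  have [g Hg gv] := orb v; have [s Ss Ks] := cS g Hg.
  exists ((s^-1 : graph_aut T) (g v)); split; first by exists s => //; exists (g v).
  exists (s^-1 * g)^-1; first exact: subgroupV.
  have [hK _ _] := inv_funP (s^-1 * g).
  exact/esym/hK.
pose c v := projT1 (cid (orbK v)).
have cS' v : [set s^-1 u | s in S & u in [set` us]] (c v) by rewrite /c; case: cid => ? [].
have cK v : exists2 g, carrier K g & v = g (c v) by rewrite /c; case: cid => ? [].
apply: (few_cosets_fun (h := fun g => c ((g^-1 : graph_aut T) v0))).
  apply: (@sub_finite_set _ _ [set (s^-1 : graph_aut T) u | s in S & u in [set` us]]).
    by move=> _ [g _ <-].
  by apply: finite_image2 => //; exact: finite_finpred.
move=> g h ng nh; have [a Ka ga] := cK (g^-1 v0); have [b Kb hb] := cK (h^-1 v0) => e.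
have Kab := subgroupM Ka (subgroupV Kb).
suff -> : g^-1 * h = a * b^-1 by case: Kab.
have nab : carrier (coloring_aut T n) (a * b^-1 * h^-1).
  by apply: subgroupM (subgroupV nh); case: Kab.
have -> : g^-1 = a * b^-1 * h^-1; last by rewrite mulgVK.
apply: aut_eq; apply: (equivariant_unique T_tree ln (v0 := v0) (b := n)) => //.
  exact: (subgroupV ng).
rewrite ga e /= -[X in a (inv_fun b X)]/((h^-1 : graph_aut T) v0) hb.
by have [bK _ _] := inv_funP b; rewrite bK.
Qed.

(** A uniform radius exists because there are finitely many orbits of vertices up
to H, and conjugation by H moves the centre of a ball to one of finitely many places. *)
Lemma lattice_free_on_balls (H : subgroup (graph_aut T)) v0 : cocompact_lattice H ->
  exists r, forall g (h : graph_aut T), carrier H g ->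
    (forall x, x \in word_ball n0 r v0 -> g (h x) = h x) -> g = 1.
Proof.
move=> [disc coc]; have [s sfree] := discrete_subgroup_finite_support disc.
have trans v : exists g : graph_aut T, g v = v0.
  by have [g [gv _]] := coloring_transport T_tree ln0 ln0 v v0; exists g.
have [us orb] := cocompact_finite_orbits trans coc.
have [r rP] := word_ball_cover T_tree ln0 us s; exists r => g h Hg gh.
have [k Hk kus] := orb (h v0).
have [kK Kk _] := inv_funP k.
suff : k * g * k^-1 = 1.
  move=> /(congr1 (fun z => k^-1 * z * k)); rewrite !mulgA mulVg mul1g mulgVK mulg1 mulVg.
  by [].
apply: sfree => [|x xs]; first exact: subgroupM (subgroupM Hk Hg) (subgroupV Hk).
have := rP _ _ kus xs; rewrite -[k (h v0)]/((k * h) v0) => xb.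
have [lK Kl _] := inv_funP (k * h).
have := word_ball_aut ln0 ((k * h)^-1) xb.
have y0 : ((k * h)^-1 : graph_aut T) ((k * h) v0) = v0 by exact: lK.
rewrite y0 => yb.
have hy : h (((k * h)^-1 : graph_aut T) x) = (k^-1 : graph_aut T) x.
  by apply: (can_inj kK); have := Kl x => /= ->; rewrite /= Kk.
have := gh _ yb; rewrite hy => e.
by rewrite /= in e *; rewrite e Kk.
Qed.

(** The reservoir X consists of the images, under all automorphisms, of a large ball
around v0 with its vertices listed. The parity-preserving part K of the lattice acts on it freely
and without inversions, so equivariant matchings provide moves M that commute with K,
and the previous lemmas extract a colouring preserved by a subgroup of finite index. *)
Lemma lattice_coloring (H : subgroup (graph_aut T)) : cocompact_lattice H ->
  exists2 n : 'I_d -> V -> V, legal_coloring T n & commensurable H (coloring_aut T n).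
Proof.
move=> latH; have [v0 _] := tree_inhabited T_tree.
have [r free] := lattice_free_on_balls v0 latH.
have [par parT] := parity_exists T_tree ln0.
pose K := subgroupI H (fiber_stab T par).
(* The first entries of a frame record its centre and its d edges; the ball that
   follows makes the action of K free. *)
pose bs := v0 :: [seq n0 i v0 | i <- enum 'I_d] ++ word_ball n0 r v0.
pose inX (s : seq V) := `[< exists g : graph_aut T, s = map g bs >].
pose X := {s : seq V | inX s}.
have inX_ax (g : graph_aut T) s : inX s -> inX (map g s).
  by move=> /asboolP[h ->]; apply/asboolP; exists (g * h); rewrite -map_comp.
pose ax (g : graph_aut T) (x : X) : X := exist _ (map g (val x)) (inX_ax g _ (valP x)).
pose pi (x : X) := nth v0 (val x) 0.
pose e (i : 'I_d) (x : X) := nth v0 (val x) i.+1.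
have Xrep (x : X) : exists g : graph_aut T, val x = map g bs by exact/asboolP/(valP x).
have size_bs : size bs = (1 + d + size (word_ball n0 r v0))%N.
  by rewrite /= size_cat size_map size_enum_ord.
have bsS (i : 'I_d) : nth v0 bs i.+1 = n0 i v0.
  rewrite /= nth_cat size_map size_enum_ord ltn_ord (nth_map i) ?size_enum_ord //.
  by rewrite nth_ord_enum.
have piE (g : graph_aut T) x : pi (ax g x) = g (pi x).
  by rewrite /pi /=; have [h ->] := Xrep x.
have eE i (g : graph_aut T) x : e i (ax g x) = g (e i x).
  rewrite /e /= (nth_map v0) //; have [h ->] := Xrep x.
  by rewrite size_map size_bs add1n ltnS (leq_trans (ltn_ord i)) // leq_addr.
have pie x : exists g : graph_aut T, pi x = g v0 /\ forall i, e i x = g (n0 i v0).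
  have [g gx] := Xrep x; exists g; rewrite /pi /e gx; split=> // i.
  by rewrite (nth_map v0) ?bsS // size_bs add1n ltnS (leq_trans (ltn_ord i)) // leq_addr.
have axM (g h : graph_aut T) x : ax (g * h) x = ax g (ax h x).
  by apply: val_inj; rewrite /= -map_comp.
have ax1 x : ax 1 x = x by apply: val_inj; rewrite /= map_id.
have adj_e i x : T (pi x) (e i x).
  have [g [-> ->]] := pie x; have [_ ->] := autP g; exact: (frame_adj ln0).
have flip v w : T v w -> exists g : graph_aut T, g v = w /\ g w = v.
  move=> /(frame_surj ln0)[i ->].
  have [g [gv gn]] := coloring_transport T_tree ln0 ln0 v (n0 i v).
  by exists g; split=> //=; rewrite gn gv (frameK ln0).
have bs_ball : {subset bs <= word_ball n0 r.+1 v0}.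
  move=> x; rewrite inE mem_cat => /or3P[/eqP->|/mapP[i _ ->]|/word_ballP[w sw <-]].
  - exact: mem_head.
  - by apply/word_ballP; exists [:: i].
  - by apply/word_ballP; exists w => //; exact: leqW.
have fin v : finite_set [set x | pi x = v].
  apply: (@sub_finite_set _ _ (val @^-1` [set s : seq V |
      size s = size bs /\ {subset s <= word_ball n0 r.+1 v}])).
    move=> x <-; have [g gx] := Xrep x.
    rewrite /preimage /mkset /pi gx size_map; split=> //.
    by move=> _ /mapP[b /bs_ball/(word_ball_aut ln0 g) gb ->].
  by apply: finite_preimage; [move=> ? ? _ _; exact: val_inj|exact: finite_seqs].
have freeX (g : graph_aut T) x : carrier K g -> ax g x = x -> g = 1.
  move=> [Hg _] /(congr1 val) /=; have [h ->] := Xrep x => gx.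
  apply: (free g h) => // b bb; have bbs : b \in bs by rewrite inE mem_cat bb !orbT.
  have /eqP := gx; rewrite -map_comp => /eqP/eq_in_map; exact.
have noinv (g : graph_aut T) v : carrier K g -> ~ T v (g v).
  by move=> [_ gp] /parT; rewrite gp; case: (par v).
have exM i : exists M : X -> X, [/\ involutive M,
    forall g x, carrier K g -> M (ax g x) = ax g (M x) & forall x, pi (M x) = e i x].
  exact: (equivariant_matching axM ax1 piE (eE i) (adj_e i) flip fin freeX noinv).
pose M i := projT1 (cid (exM i)).
have MP i : [/\ involutive (M i), forall g x, carrier K g -> M i (ax g x) = ax g (M i x)
    & forall x, pi (M i x) = e i x] by rewrite /M; case: cid.
have fsM : frame_system T pi M.
  split=> [i|x i|x i j|x w].
  - by have [] := MP i.
  - by have [_ _ ->] := MP i.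
  - have [g [_ eg]] := pie x; have [gK _ _] := inv_funP g.
    have [_ _ ->] := MP i; have [_ _ ->] := MP j.
    by rewrite !eg => /(can_inj gK); exact: (frame_inj ln0).
  - have [g [-> eg]] := pie x; have [_ Kg _] := inv_funP g.
    rewrite -{1}(Kg w); have [_ ->] := autP g => /(frame_surj ln0)[i wi].
    by exists i; have [_ _ ->] := MP i; rewrite eg -wi Kg.
have x0 : X by exists bs; apply/asboolP; exists 1; rewrite map_id.
have [n ln fK] := frame_coloring_few_cosets x0 T_tree fsM axM ax1 piE
  (fun i g x Kg => let: And3 _ h _ := MP i in h g x Kg) fin.
exists n => //; have fH : few_cosets H (coloring_aut T n).
  exact: few_cosets_trans (few_cosets_parity T_tree ln0 _ parT) fK.
have trans v : exists g : graph_aut T, g v = v0.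
  by have [g [gv _]] := coloring_transport T_tree ln0 ln0 v v0; exists g.
have [us orb] := cocompact_finite_orbits trans latH.2.
by apply/commensurableP; split=> //; exact: few_cosets_coloring_aut ln fH orb.
Qed.

End LatticeMain.

(** * Homomorphisms onto free abelian groups *)

Section HomToFree.
Variables (C : groupType) (I : choiceType) (phi : C -> {freeg I}).
Hypothesis phiM : {morph phi : x y / x * y >-> (x + y)%R}.

Lemma hom1 : phi 1 = 0%R.
Proof. by apply: (@GRing.addrI _ (phi 1)); rewrite -phiM mulg1 GRing.addr0. Qed.

Lemma homV x : phi x^-1 = (- phi x)%R.
Proof. by apply: (@GRing.addrI _ (phi x)); rewrite -phiM mulgV hom1 GRing.subrr. Qed.

Program Definition ker_subgroup : subgroup C :=
  @Subgroup C [set x | phi x = 0%R]%classic _ _ _.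
Next Obligation. exact: hom1. Qed.
Next Obligation. by move=> x y /= hx hy; rewrite phiM hx hy GRing.addr0. Qed.
Next Obligation. by move=> x /= hx; rewrite homV hx GRing.oppr0. Qed.

Program Definition ker_normal_subgroup : normal_subgroup C :=
  @NormalSubgroup C ker_subgroup _.
Next Obligation.
by move=> x y /= hx; rewrite !phiM homV hx GRing.addr0 GRing.subrr.
Qed.

(** The first isomorphism theorem. *)
Lemma quotient_ker_free : infinite_set [set: I] -> (forall D, exists x, phi x = D) ->
  free_abelian_of_infinite_rank (quotient_group ker_normal_subgroup).
Proof.
move=> infI phi_onto.
pose f (a : quotient_group ker_normal_subgroup) := phi (generic_quotient.repr a).
have fE x : f (\pi_(quotient_group ker_normal_subgroup) x) = phi x.
  rewrite /f; case: piP => y /quotient_eqP/asboolP /=.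
  by rewrite phiM homV => h; apply/eqP; rewrite -GRing.subr_eq0 GRing.addrC h.
exists I, f; split=> //.
  exists (fun D => \pi_(quotient_group ker_normal_subgroup) (projT1 (cid (phi_onto D)))).
    move=> a; rewrite -[a]generic_quotient.reprK fE; case: cid => y /= hy.
    apply/quotient_eqP/asboolP => /=.
    by rewrite phiM homV hy GRing.addNr.
  by move=> D; rewrite fE; case: cid.
move=> a b; rewrite -[a]generic_quotient.reprK -[b]generic_quotient.reprK.
by rewrite -[X in f X]pi_mulg !fE phiM.
Qed.

(** Free abelian groups have no torsion. *)
Lemma hom_involution x : x * x = 1 -> phi x = 0%R.
Proof.
move=> x2; apply/eqP/freeg_eqP => k; rewrite coeff0.
have := congr1 (coeff k) (phiM x x); rewrite x2 hom1 coeff0 coeffD => /esym/eqP.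
by rewrite -GRing.mulr2n Num.Theory.mulrn_eq0 /= => /eqP.
Qed.

End HomToFree.

(** By induction on a bound for the ranks of the support of D: the coefficient of highest
rank is removed by subtracting a multiple of the value at a suitable g. *)
Lemma triangular_onto (C : groupType) (I : choiceType) (rk : I -> nat)
    (phi : C -> {freeg I}) :
  injective rk -> {morph phi : x y / x * y >-> (x + y)%R} ->
  (forall p, exists2 g, coeff p (phi g) = 1%R &
     forall q, (rk p < rk q)%N -> coeff q (phi g) = 0%R) ->
  forall D, exists x, phi x = D.
Proof.
move=> rk_inj phiM tri.
have cMz k (E : {freeg I}) c : coeff k (E *~ c)%R = (coeff k E *~ c)%R.
  by rewrite raddfMz.
have im0 : exists x, phi x = 0%R by exists 1; exact: hom1.
have imD D E : (exists x, phi x = D) -> (exists x, phi x = E) ->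
    exists x, phi x = (D + E)%R.
  by move=> [x <-] [y <-]; exists (x * y).
have imN D : (exists x, phi x = D) -> exists x, phi x = (- D)%R.
  by move=> [x <-]; exists x^-1; rewrite homV.
have imZ D (c : int) : (exists x, phi x = D) -> exists x, phi x = (D *~ c)%R.
  move=> ex; have imMn n : exists x, phi x = (D *+ n)%R.
    by elim: n => [|n IH]; rewrite ?GRing.mulr0n // GRing.mulrS; exact: imD.
  by case: c => n; [exact: imMn|exact/imN/imMn].
have step n D : (forall q, coeff q D != 0%R -> (rk q < n)%N) -> exists x, phi x = D.
  elim: n D => [|n IH] D hD.
    suff -> : D = 0%R by [].
    apply/eqP/freeg_eqP => q; rewrite coeff0; apply/eqP/negPn/negP.
    by move/hD.
  case: (pselect (exists p, rk p = n)) => [[p pn]|np]; last first.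
    apply: IH => q /[dup] qD /hD; rewrite ltnS leq_eqVlt => /orP[/eqP qn|//].
    by case: np; exists q.
  have [g g1 g0] := tri p.
  pose E := (D - phi g *~ coeff p D)%R.
  rewrite -[D](GRing.subrK (phi g *~ coeff p D)%R); apply: imD; last first.
    by apply: imZ; exists g.
  apply: IH => q; rewrite ltnNge; apply: contraNN => nq; rewrite coeffB cMz.
  have [qp|nqp] := eqVneq q p.
    by rewrite qp g1 intz GRing.subrr.
  have pq : (rk p < rk q)%N by rewrite pn ltn_neqAle nq andbT -pn (inj_eq rk_inj) eq_sym.
  rewrite g0 // mul0rz GRing.subr0; apply/negPn/negP => /hD.
  by rewrite -pn ltnS leqNgt pq.
move=> D; apply: (step (\max_(q <- dom D) rk q).+1) => q.
by rewrite -mem_dom ltnS => qD; exact: leq_bigmax_seq.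
Qed.

(** Simplicity of an abelian group will be tested on its subgroup of squares. *)
Section Squares.
Variable G : groupType.
Hypothesis mulC : commutative (@mulg G).

Program Definition square_subgroup : subgroup G :=
  @Subgroup G [set h * h | h in setT] _ _ _.
Next Obligation. by exists 1; rewrite ?mulg1. Qed.
Next Obligation.
move=> _ _ [x _ <-] [y _ <-]; exists (x * y) => //.
by rewrite !mulgA; congr (_ * y); rewrite -!mulgA; congr (x * _).
Qed.
Next Obligation. by move=> _ [x _ <-]; exists x^-1; rewrite // invgM. Qed.

Program Definition square_normal_subgroup : normal_subgroup G :=
  @NormalSubgroup G square_subgroup _.
Next Obligation. by move=> x y /=; rewrite (mulC y) mulgK. Qed.

End Squares.

(** Let H be simple of finite index. If phi vanishes on H, then phi takes finitely many
values. Otherwise phi is injective on H, so H is abelian and torsion-free; its squares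
then form all of H, and nonzero values of phi would be divisible by all powers of 2. *)
Lemma not_virtually_simple_of_onto_free (C : groupType) (I : choiceType)
    (phi : C -> {freeg I}) :
  [set: I] !=set0 -> {morph phi : x y / x * y >-> (x + y)%R} ->
  (forall D, exists x, phi x = D) -> ~ virtually_simple C.
Proof.
move=> [p _] phiM phi_onto [H finH [[x0 x0N1] simH]].
pose psi (h : set_type H) := phi (val h).
have psiM : {morph psi : x y / x * y >-> (x + y)%R} by move=> x y; rewrite /psi -phiM.
have psi1 : psi 1 = 0%R by exact: (hom1 phiM).
have psiV x : psi x^-1 = (- psi x)%R by exact: (homV phiM).
have [k1|kT] := simH (ker_normal_subgroup psiM); last first.
  have phiH x : carrier H x -> phi x = 0%R.
    move=> Hx; pose h : set_type H := exist _ x (mem_set Hx).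
    have : [set: set_type H] h by []. 
    by rewrite -kT.
  have /finite_seqP[s sE] : finite_set (range phi).
    have : finite_set
        ((phi \o generic_quotient.repr) @` [set \pi_(coset_space H) x | x in setT]).
      exact: finite_image.
    apply: sub_finite_set => _ [x _ <-]; exists (\pi_(coset_space H) x); first by exists x.
    rewrite /=; case: piP => y /coset_eqP/phiH; rewrite phiM (homV phiM) => h.
    by apply/eqP; rewrite -GRing.subr_eq0 GRing.addrC h.
  pose b := \max_(D <- s) `|coeff p D|%N.
  have [x hx] := phi_onto << b.+1%:Z *g p >>%R.
  have : [set` s] (phi x) by rewrite -sE; exists x.
  rewrite /= hx => xs.
  have := @leq_bigmax_seq _ s xpredT (fun D => `|coeff p D|%N) _ xs isT.
  by rewrite coeffU eqxx GRing.mulr1 absz_nat -/b ltnn.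
have psi_inj x y : psi x = psi y -> x = y.
  move=> xy; have : carrier (ker_normal_subgroup psiM) (x * y^-1).
    by rewrite /= psiM psiV xy GRing.subrr.
  by rewrite k1 => /(congr1 (fun z => z * y)); rewrite mulgVK mul1g.
have mulC (x y : set_type H) : x * y = y * x by apply: psi_inj; rewrite !psiM GRing.addrC.
have psi0 : psi x0 <> 0%R.
  by move=> h; apply: x0N1; apply: psi_inj; rewrite h psi1.
have [l1|lT] := simH (square_normal_subgroup mulC).
  apply: psi0; have : carrier (square_normal_subgroup mulC) (x0 * x0) by exists x0.
  by rewrite l1 => /(congr1 val)/= h; exact: (hom_involution phiM).
have div n : exists y, psi x0 = (psi y *+ (2 ^ n))%R.
  elim: n => [|n [y hy]]; first by exists x0; rewrite GRing.mulr1n.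
  have : carrier (square_normal_subgroup mulC) y by rewrite lT.
  move=> -[z _ zz]; exists z; rewrite hy -zz psiM -GRing.mulr2n -GRing.mulrnA.
  by rewrite expnS.
apply: psi0; apply/eqP/freeg_eqP => q; rewrite coeff0; apply/eqP/negPn/negP => nz.
pose c := coeff q (psi x0); have [y hy] := div `|c|%N.
have : `|c|%N = (`|coeff q (psi y)| * 2 ^ `|c|)%N.
  rewrite {1}/c hy coeffMn -GRing.mulr_natr abszM.
  by congr (_ * _)%N; rewrite natz absz_nat.
move=> cE; have : (0 < `|c|)%N by rewrite absz_gt0.
rewrite {1}cE muln_gt0 => /andP[y0 _].
have := ltn_expl `|c| (ltnSn 1); rewrite {1}cE ltnNge.
by rewrite leq_pmull.
Qed.

(** * A sufficient condition on a commensurated subgroup *)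

Lemma freeg_of_coeff (K : choiceType) (F : K -> int) (s : seq K) :
  (forall k, F k != 0%R -> k \in s) -> exists D : {freeg K}, forall k, coeff k D = F k.
Proof.
move=> sF; exists [freeg [seq (F k, k) | k <- undup s]] => k; rewrite coeff_Freeg.
have dE : predom [seq (F k, k) | k <- undup s] = undup s.
  by rewrite /predom -map_comp map_id.
have [ks|ks] := boolP (k \in s).
  apply: (precoeff_mem_uniqE (kz := (F k, k))); first by rewrite dE undup_uniq.
  by apply: map_f; rewrite mem_undup.
rewrite precoeff_outdom; last by rewrite dE mem_undup.
by apply/esym/eqP/negPn/negP => /sF; apply/negP.
Qed.

(** The bound 4 makes the alternating group of degree p simple. *)
Definition big_prime := {p : nat | prime p && (4 < p)%N}.

Lemma infinite_big_prime : infinite_set [set: big_prime].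
Proof.
move=> /finite_seqP[s sE].
have [p lt_p p_pr] := prime_above (4 + \max_(q <- s) val q).
have Pp : prime p && (4 < p)%N by rewrite p_pr (leq_ltn_trans (leq_addr _ _) lt_p).
have : [set` s] (Sub p Pp : big_prime) by rewrite -sE.
rewrite /= => ps; move: lt_p; apply/negP; rewrite -leqNgt.
apply: leq_trans (leq_addl _ _).
by rewrite -[p]/(val (Sub p Pp : big_prime)) leq_bigmax_seq.
Qed.

Lemma commensurator_onto_free (G : groupType) (A : subgroup G) :
  (forall p : big_prime, exists g, [/\ carrier (commensurator A) g,
     comm_hom (val p) A g = 1%R &
     forall q, prime q -> (val p < q)%N -> comm_hom q A g = 0%R]) ->
  exists phi : set_type (commensurator A) -> {freeg big_prime},
    {morph phi : x y / x * y >-> (x + y)%R} /\ forall D, exists x, phi x = D.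
Proof.
move=> wit.
have exD (g : set_type (commensurator A)) :
    exists D : {freeg big_prime}, forall q, coeff q D = comm_hom (val q) A (val g).
  have [b hb] := comm_hom_bounded (set_mem (valP g)).
  apply: (freeg_of_coeff (s := pmap insub (iota 0 b.+1))) => q nz.
  rewrite mem_pmap_sub mem_iota add0n ltnS /= leqNgt; apply/negP => lt_bq.
  by move: nz; rewrite hb ?eqxx //; case/andP: (valP q).
pose phi g := projT1 (cid (exD g)).
have phiE g q : coeff q (phi g) = comm_hom (val q) A (val g) by rewrite /phi; case: cid.
have phiM : {morph phi : x y / x * y >-> (x + y)%R}.
  move=> x y; apply/eqP/freeg_eqP => q; rewrite coeffD !phiE comm_homM //.
  - by case/andP: (valP q).
  - exact: set_mem (valP x).
  - exact: set_mem (valP y).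
exists phi; split=> //.
have rk_inj : injective (fun p : big_prime => val p) by exact: val_inj.
apply: (triangular_onto rk_inj phiM) => p.
have [g [Cg g1 g0]] := wit p; exists (exist _ g (mem_set Cg)); first by rewrite phiE.
by move=> q pq; rewrite phiE g0 //; case/andP: (valP q).
Qed.

Lemma free_quotient_of_witnesses (G : groupType) (A : subgroup G) :
  (forall p : big_prime, exists g, [/\ carrier (commensurator A) g,
     comm_hom (val p) A g = 1%R &
     forall q, prime q -> (val p < q)%N -> comm_hom q A g = 0%R]) ->
  (exists2 a, carrier (commensurator A) a & a <> 1 /\ a * a = 1) ->
  (exists N : normal_subgroup (commensurator A),
      carrier N <> [set 1%g] /\
      free_abelian_of_infinite_rank (quotient_group N)) /\
  ~ virtually_simple (commensurator A).
Proof.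
move=> wit [a Ca [a1 aa]]; have [phi [phiM phi_onto]] := commensurator_onto_free wit.
split; last first.
  exact: not_virtually_simple_of_onto_free (infinite_setN0 infinite_big_prime) phiM phi_onto.
exists (ker_normal_subgroup phiM); split; last first.
  exact: (quotient_ker_free phiM infinite_big_prime phi_onto).
pose x : set_type (commensurator A) := exist _ a (mem_set Ca).
have : carrier (ker_normal_subgroup phiM) x.
  by apply: (hom_involution phiM); apply: val_inj.
by move=> xk kE; move: xk; rewrite kE => /(congr1 val)/= /a1.
Qed.

(** * The commensurator of a cocompact lattice *)

Lemma commensurable_sym (G : groupType) (A B : subgroup G) :
  commensurable A B -> commensurable B A.
Proof. by move=> /commensurableP[AB BA]; apply/commensurableP. Qed.

Lemma commensurable_trans (G : groupType) (A B C : subgroup G) :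
  commensurable A B -> commensurable B C -> commensurable A C.
Proof.
move=> /commensurableP[AB BA] /commensurableP[BC CB]; apply/commensurableP.
by split; [exact: few_cosets_trans AB BC|exact: few_cosets_trans CB BA].
Qed.

Lemma commensurator_eq (G : groupType) (A B : subgroup G) :
  commensurable A B -> commensurator A = commensurator B.
Proof.
have sub C D g : commensurable C D -> carrier (commensurator C) g ->
    carrier (commensurator D) g.
  move=> CD Cg; apply: commensurable_trans (commensurable_sym CD) _.
  exact: commensurable_trans Cg (commensurableJ g CD).
by move=> AB; apply: subgroup_ext => g; split; apply: sub => //; exact: commensurable_sym.
Qed.

Section ColoringWitnesses.
Variables (V : choiceType) (T : rel V) (d : nat) (n : 'I_d -> V -> V).
Hypothesis T_tree : is_tree T.
Hypothesis ln : legal_coloring T n.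
Hypothesis d_ge3 : (3 <= d)%N.

Lemma coloring_aut_witness (p : big_prime) : exists g,
  [/\ carrier (commensurator (coloring_aut T n)) g,
      comm_hom (val p) (coloring_aut T n) g = 1%R &
      forall q, prime q -> (val p < q)%N -> comm_hom q (coloring_aut T n) g = 0%R].
Proof.
case: p => p /= /andP[p_pr p_gt4]; case: p p_pr p_gt4 => [|[|m]] // p_pr p_gt4.
have [g gC gE] := @recoloring_witness V T d n _ _ _ _ 0%R T_tree ln
  (@dih_permK m d) (@sym_permK m d) (recolorK d_ge3) (recolor_edge d_ge3) (sym_dih d_ge3).
exists g; split=> // [|q q_pr lt_pq].
  by rewrite gE ?card_ord // count_dih // count_sym.
by rewrite gE ?card_ord ?(ltnW lt_pq) // !(count_large _ q_pr lt_pq).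
Qed.

(** The automorphism of the colouring that flips an edge: it serves as a nontrivial element
of the kernel of every homomorphism to a torsion-free group. *)
Lemma coloring_aut_involution :
  exists2 g, carrier (commensurator (coloring_aut T n)) g & g <> 1 /\ g * g = 1.
Proof.
have [v0 _] := tree_inhabited T_tree; pose i0 : 'I_d := Ordinal (ltnW (ltnW d_ge3)).
have [g [gv gn]] := coloring_transport T_tree ln ln v0 (n i0 v0).
exists g.
  rewrite /= (conj_coloring_aut gn); apply/commensurableP.
  by split; exists [set 1] => // x nx; exists 1; rewrite // invg1 mul1g.
split=> [g1|].
  have := frame_adj ln v0 i0; rewrite /= -gv g1 /=.
  by rewrite (tree_irr T_tree).
apply: aut_eq; apply: (equivariant_unique T_tree ln (v0 := v0) (b := n)) => //=.
  by move=> i v; rewrite !gn.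
by rewrite gv gn gv (frameK ln).
Qed.

End ColoringWitnesses.

Theorem theorem1 (d : nat) (d_ge3 : (3 <= d)%N)
    (V : choiceType) (T : rel V) (T_tree : is_tree T)
    (T_regular : regular_graph T d)
    (Gamma : subgroup (graph_aut T)) (Gamma_lattice : cocompact_lattice Gamma) :
  (exists N : normal_subgroup (commensurator Gamma),
      carrier N <> [set 1%g]%classic /\
      free_abelian_of_infinite_rank (quotient_group N)) /\
  ~ virtually_simple (commensurator Gamma).
Proof.
have [n0 ln0] := coloring_exists T_tree (ltnW (ltnW d_ge3)) T_regular.
have [n ln comm] := lattice_coloring T_tree ln0 Gamma_lattice.
rewrite (commensurator_eq comm); apply: free_quotient_of_witnesses.
  by move=> p; exact: coloring_aut_witness.
exact: coloring_aut_involution.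
Qed.
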